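(* Let $X$, $U$, $W_*$ be normed spaces, $W=(W_* )^*$, $\Omega_X\subset X$, $\Omega_U\subset U$, $E:X\to\mathbb{R}$, and $R:X\to(-\infty,\infty]$ convex, proper and lower semicontinuous. Assume $\inf[E+R]>-\infty$. Given an initial iterate $x^0\in\Omega_X$ and $\tau>0$, let $\{x^k\}_{k\in\mathbb{N}}$ be generated by the outer forward-backward step $$x^{k+1}=\operatorname*{arg\,min}_{z\in X}\Bigl\{\tau\langle\tilde x^*_{k+1}|z-x^k\rangle+\tau R(z)+\tfrac12\|z-x^k\|^2\Bigr\},$$ where the differential estimates $\tilde x^*_{k+1}\in X^*$, the target sets $\mathscr{d}E(x^k)\subset X^*$, and the targets $x^*_{k+1}\in\mathscr{d}E(x^k)$ are such that the tracking assumption (see context) holds, and such that, for some $L>0$, $$\inf_{x^*\in\mathscr{d}E(x^k)}\langle x^*|x-x^k\rangle\ge E(x)-E(x^k)-\tfrac L2\|x-x^k\|^2\quad\text{for all }k\in\mathbb{N}\text{ and }x\in\mathrm{dom}\,R.$$ Assume also that $\{x\in X\mid[E+R](x)\le[E+R](x^0)+\Psi_1\}\subset\Omega_X$, and that the step length satisfies $\tau(L+1+\varsigma_1^2)<2$, where $\Psi_1$ and $\varsigma_1$ are the constants defined in the context. Then $\|u^{k+1}-S_u(x^k)\|_U\to0$. Moreover: (i) If $X$ is a Hilbert space, then $$\inf_{x^*\in\mathscr{d}E(x^k)}\|\mathrm{prox}_{\tau R}(x^k-\tau\mathscr{R}x^* )-x^k\|\to0.$$ (ii) Suppose that either (a)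 for all $\epsilon>0$ there exists $\delta>0$ such that, for some $k_N\in\mathbb{N}$, for any $k\ge k_N$, $$\|x^{k+1}-x^k\|\le\delta\implies\mathrm{dist}(\mathscr{d}E(x^{k+1}),x^*_{k+1})\le\epsilon;\quad\text{or}$$ (b) $E$ is bounded from below and $\partial R$ is single-valued and Lipschitz on the restricted sublevel sets $\{x\in\Omega_X\mid R(x)\le c\}$ for every $c\in\mathbb{R}$. Then also $\inf_{x^*\in[\mathscr{d}E+\partial R](x^{k+1})}\|x^*\|\to0$.
   Context: $\mathrm{dom}\,R=\{x\mid R(x)<\infty\}$; $\partial R$ is the convex subdifferential; $\mathrm{prox}_{\tau R}$ is the proximal map; $\mathscr{R}x^*\in X$ is the Riesz representation of $x^*\in X^*$; $\mathrm{dist}(B,a)=\inf_{b\in B}\|a-b\|$; $[\mathscr{d}E+\partial R](x)=\mathscr{d}E(x)+\partial R(x)$. Tracking assumption. Let $S_u:\Omega_X\to U$ and $S_w:\Omega_X\to W$ be given single-valued maps (selections of exact inner and adjoint solutions). On iterations $k\ge0$, alongside $x^k$, there are given inner iterates $u^k\in\Omega_U$, adjoint iterates $w^k\in W$, and residuals $\Delta w_*^{k+1}\in W_*$, $\Delta u^*_{k+1}\in U^*$. For some norms $\|\cdot\|_*$ on $W_*$ and $\|\cdot\|_{**}$ on $U^*$, set $$d^u_{k+1}=\|u^{k+1}-S_u(x^k)\|_U+\|\Delta w_*^{k+1}\|_*,\quad d^w_{k+1}=\|w^{k+1}-S_w(x^k)\|_W+\|\Delta u^*_{k+1}\|_{**},\quad\varrho_k=\|x^k-x^{k-1}\|_X.$$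 It is assumed that there are constants $\pi_u,\pi_w,\mu_u>0$, $\kappa_u,\kappa_w>1$, $\alpha_u,\alpha_w\ge0$ such that, for every $k\ge 0$ for which $\{(x^n,u^n,w^n)\}_{n=0}^k\subset\Omega_X\times\Omega_U\times W$: - (inner tracking) if $k\ge1$, $\kappa_ud^u_{k+1}\le d^u_k+\pi_u\varrho_k$; - (adjoint tracking) if $k\ge1$, $\kappa_wd^w_{k+1}\le d^w_k+\mu_ud^u_{k+1}+\pi_w\varrho_k$; - (differential transformation) $\|\tilde x^*_{k+1}-x^*_{k+1}\|_{X^*}\le\alpha_ud^u_{k+1}+\alpha_wd^w_{k+1}$. The inner iterates satisfy $u^k\in\Omega_U$ for all $k$. Constants. $\kappa=\min\{\kappa_u,\kappa_w\}$, $\overline\kappa=\max\{\kappa_u,\kappa_w\}$, $\iota_j=\sum_{m=1}^j\kappa_u^{-m}\kappa_w^{-(j+1-m)}$ (so $\iota_0=0$), $\psi_j=\alpha_u\kappa_u^{-j}\pi_u+\alpha_w[\iota_j\mu_u\pi_u+\kappa_w^{-j}\pi_w]$, $$\varsigma_1=\overline\kappa\sum_{j=0}^\infty\psi_j\le\frac{(\alpha_u\pi_u+\alpha_w\pi_w)\kappa\overline\kappa}{\kappa-1}+\frac{\alpha_w\mu_u\pi_u\overline\kappa}{(\kappa-1)^2},$$ $$\Psi_1=\frac{(d^u_1)^2}{\pi_u}\Bigl(\frac{\varsigma_1\alpha_u\kappa}{\kappa-1}+\frac{\varsigma_1\alpha_w\mu_u}{(\kappa-1)^2}\Bigr)+\frac{(d^w_1)^2}{\pi_w}\,\frac{\varsigma_1\alpha_w\kappa}{\kappa-1}.$$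 *)

(* Defs.v *)
From HB Require Import structures.
From mathcomp Require Import all_boot all_order all_algebra.
From mathcomp Require Import all_classical all_reals all_analysis.

Set Implicit Arguments.
Unset Strict Implicit.
Unset Printing Implicit Defensive.

Import Order.TTheory GRing.Theory Num.Theory.
Import numFieldNormedType.Exports.

Local Open Scope classical_set_scope.
Local Open Scope ring_scope.

(** The topological dual [X^*], as a normed space for the operator norm.
    [scalar f] is linearity into the base field; the pairing [<f|x>] is plain
    application [f x]. *)

Definition dual_pred (K : realType) (X : normedModType K) : {pred X -> K} :=
  [pred f : X -> K | `[< scalar f /\ continuous f >]].

Record dual (K : realType) (X : normedModType K) := Dual {
  dual_fun :> X -> K ;
  _ : dual_fun \in @dual_pred K X }.

Section dual_normed_space.
Context {K : realType} {X : normedModType K}.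

HB.instance Definition _ := [isSub of dual X for @dual_fun K X].
HB.instance Definition _ := [Choice of dual X by <:].

Fact dual_submod_closed : submod_closed (@dual_pred K X).
Proof.
split=> [|a f g].
  apply/asboolP; split=> [a u v|]; last exact: cst_continuous.
  by rewrite /= mulr0 addr0.
move=> /asboolP[lf cf] /asboolP[lg cg]; apply/asboolP; split=> [b u v|x].
  rewrite /= !fctE lf lg /=.
  change (a * (b * f u + f v) + (b * g u + g v) =
          b * (a * f u + g u) + (a * f v + g v)).
  by rewrite !mulrDr addrACA; congr (_ + _ + _); rewrite mulrCA.
by apply: cvgD; [apply: cvgMl_tmp; exact: cf|exact: cg].
Qed.

HB.instance Definition _ :=
  GRing.isSubmodClosed.Build K (X -> K) (@dual_pred K X) dual_submod_closed.
HB.instance Definition _ := [SubChoice_isSubLmodule of dual X by <:].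

Definition opnorm (f : dual X) : K :=
  sup [set `|f x| | x in [set x : X | `|x| <= 1]].

Lemma dual_linear (f : dual X) : scalar f.
Proof. by case: f => f /= /asboolP[]. Qed.

Lemma dual_continuous (f : dual X) : continuous f.
Proof. by case: f => f /= /asboolP[]. Qed.

Lemma dualDE (f g : dual X) x : (f + g) x = f x + g x. Proof. by []. Qed.
Lemma dualZE (a : K) (f : dual X) x : (a *: f) x = a * f x. Proof. by []. Qed.

Lemma dual_map0 (f : dual X) : f 0 = 0.
Proof. by have := dual_linear f (-1) 0 0; rewrite scaleN1r addNr mulN1r addNr. Qed.

Lemma dual_mapZ (f : dual X) a x : f (a *: x) = a * f x.
Proof. by have := dual_linear f a x 0; rewrite dual_map0 !addr0. Qed.

Lemma opnorm_has_sup (f : dual X) :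
  has_sup [set `|f x| | x in [set x : X | `|x| <= 1]].
Proof.
split; first by exists `|f 0|, 0 => //=; rewrite normr0.
have /cvgrPdist_lt/(_ _ ltr01) := @dual_continuous f 0.
move=> /nbhs_norm0P[e /= e0 He]; exists (2 / e) => _ [x /= x1 <-].
have e20 : 0 < e / 2 by rewrite divr_gt0.
have : `|e / 2 *: x| < e.
  rewrite normrZ gtr0_norm// (@le_lt_trans _ _ (e / 2))//.
    by rewrite ler_piMr// ltW.
  by rewrite ltr_pdivrMr// mulr_natr mulr2n ltrDl.
move=> /He /=; rewrite dual_map0 sub0r normrN dual_mapZ normrM gtr0_norm//.
by move=> /ltW; rewrite -ler_pdivlMl// invf_div mulr1.
Qed.

Lemma ler_opnorm (f : dual X) x : `|f x| <= opnorm f * `|x|.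
Proof.
have [->|x0] := eqVneq x 0; first by rewrite dual_map0 !normr0 mulr0.
have nx0 : 0 < `|x| by rewrite normr_gt0.
rewrite -ler_pdivrMr//; apply: ub_le_sup; first by case: (opnorm_has_sup f).
exists (`|x|^-1 *: x) => /=.
  by rewrite normrZ gtr0_norm ?invr_gt0// mulVf// gt_eqF.
by rewrite dual_mapZ normrM gtr0_norm ?invr_gt0// mulrC.
Qed.

Lemma opnorm_le (f : dual X) (M : K) : 0 <= M ->
  (forall x, `|f x| <= M * `|x|) -> opnorm f <= M.
Proof.
move=> M0 fM; apply: ge_sup; first by case: (opnorm_has_sup f).
by move=> _ [x /= x1 <-]; rewrite (le_trans (fM x))// ler_piMr.
Qed.

Lemma opnorm_ge0 (f : dual X) : 0 <= opnorm f.
Proof.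
apply: (@le_trans _ _ `|f 0|) => //; apply: ub_le_sup.
  by case: (opnorm_has_sup f).
by exists 0 => //=; rewrite normr0.
Qed.

Lemma opnormD (f g : dual X) : opnorm (f + g) <= opnorm f + opnorm g.
Proof.
apply: opnorm_le => [|x]; first by rewrite addr_ge0// opnorm_ge0.
by rewrite dualDE mulrDl (le_trans (ler_normD _ _))// lerD// ler_opnorm.
Qed.

Lemma opnormZ_le (a : K) (f : dual X) : opnorm (a *: f) <= `|a| * opnorm f.
Proof.
apply: opnorm_le => [|x]; first by rewrite mulr_ge0// opnorm_ge0.
by rewrite dualZE normrM -mulrA ler_wpM2l// ler_opnorm.
Qed.

Lemma opnormZ (a : K) (f : dual X) : opnorm (a *: f) = `|a| * opnorm f.
Proof.
apply/eqP; rewrite eq_le opnormZ_le/=.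
have [->|a0] := eqVneq a 0; first by rewrite normr0 mul0r opnorm_ge0.
rewrite -ler_pdivlMl ?normr_gt0// -normfV.
by rewrite -{1}(scale1r f) -(mulVf a0) -scalerA opnormZ_le.
Qed.

Lemma opnorm0_eq0 (f : dual X) : opnorm f = 0 -> f = 0.
Proof.
move=> f0; apply: val_inj; apply/funext => x /=; apply/eqP.
by rewrite -normr_le0 (le_trans (ler_opnorm f x))// f0 mul0r.
Qed.

HB.instance Definition _ :=
  Lmodule_isNormed.Build K (dual X) opnormD opnormZ opnorm0_eq0.

End dual_normed_space.

(** Norms on a vector space that need not be the ambient norm of its type. *)
Definition is_norm (K : realType) (V : lmodType K) (N : V -> K) :=
  [/\ forall v, N v = 0 -> v = 0,
      forall a v, N (a *: v) = `|a| * N v &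
      forall v w, N (v + w) <= N v + N w].

Section convex_analysis.
Context {K : realType} {X : normedModType K}.
Implicit Types (f : X -> \bar K) (x y z v : X) (ip : X -> X -> K).
Local Open Scope ereal_scope.

Definition convex_efun f := forall x y (t : K), (0 < t < 1)%R ->
  f (t *: x + (1 - t) *: y)%R <= t%:E * f x + (1 - t)%:E * f y.

(** Includes that the values lie in [(-oo, +oo]]. *)
Definition proper_efun f := (forall x, -oo < f x) /\ exists x, f x < +oo.

Definition edom f : set X := [set x | f x < +oo].

Definition subdiff f x : set (dual X) :=
  [set xs : dual X | f x \is a fin_num /\
    forall y, f x + (xs (y - x)%R)%:E <= f y].

Definition argmin f : set X := [set z | forall y, f z <= f y].

(** [xget] picks an element of a set, here of the (singleton, when [f] is
    convex, proper and lower semicontinuous on a Hilbert space) minimizer set. *)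
Definition prox f v : X :=
  xget 0%R (argmin (fun z => f z + (2^-1 * `|z - v| ^+ 2)%:E)).

(** [X] is a Hilbert space with inner product [ip]. *)
Definition is_hilbert ip := (
  [/\ forall a x y z, ip (a *: x + y) z = a * ip x z + ip y z,
      forall x y, ip x y = ip y x,
      forall x, ip x x = `|x| ^+ 2 &
      forall F : set_system X, ProperFilter F -> cauchy F -> cvg F])%R.

(** The vector [r], existing and unique in a Hilbert space, with [<r, y> = xs y]. *)
Definition riesz ip (xs : dual X) : X :=
  xget 0%R [set r | forall y, ip r y = xs y].

Definition set_dist (B : set (dual X)) (a : dual X) : \bar K :=
  ereal_inf [set `|a - b|%:E | b in B].

End convex_analysis.

(** [d_k = |v^k - S(x^(k-1))| + N(r^k)]; only meaningful for [k >= 1], since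
    [k.-1] truncates at [0]. *)
Definition track_dist (K : realType) (X V : normedModType K) (Y : lmodType K)
    (N : Y -> K) (S : X -> V) (x : nat -> X) (v : nat -> V) (r : nat -> Y)
    (k : nat) : K :=
  `|v k - S (x k.-1)| + N (r k).

Section constants.
Context {K : realType}.
Variables pi_u pi_w mu_u kap_u kap_w al_u al_w : K.

Definition iota_c (j : nat) : K :=
  \sum_(1 <= m < j.+1) kap_u ^- m * kap_w ^- (j.+1 - m).

Definition psi_c (j : nat) : K :=
  al_u * kap_u ^- j * pi_u +
  al_w * (iota_c j * mu_u * pi_u + kap_w ^- j * pi_w).

(** The series converges when [kap_u, kap_w > 1]; [limn] is total. *)
Definition varsigma1 : K := Num.max kap_u kap_w * limn (series psi_c).

Definition Psi1 (du1 dw1 : K) : K :=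
  let kap := Num.min kap_u kap_w in
  du1 ^+ 2 / pi_u *
    (varsigma1 * al_u * kap / (kap - 1) +
     varsigma1 * al_w * mu_u / (kap - 1) ^+ 2) +
  dw1 ^+ 2 / pi_w * (varsigma1 * al_w * kap / (kap - 1)).

End constants.

(* Main.v *)
(** The step [x^(k+1)] minimizes a convex function plus [|z - x^k|^2 / 2], so
    comparing it with points of the segment towards [x^k] gives, together with
    the descent inequality for [E],
    [F(x^(k+1)) + (1/tau - L/2) r_k^2 <= F(x^k) + e_k r_k], where [F = E + R],
    [r_k = |x^(k+1) - x^k|] and [e_k] is the error of the differential estimate.
    A recursion [kap d_(k+1) <= d_k + g_k] with [kap > 1] bounds the l^2 norm
    of [d] by that of [g]; applied to both tracking inequalities it yields
    [sum e_k^2 <= s1^2 sum r_k^2 + Psi1].  By Young's inequality and the step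
    length condition, [F(x^k)] stays below [F(x^0) + Psi1], which keeps the
    iterates in [Omega_X], and [sum r_k^2 < oo].  Hence [r], [d^u], [d^w] and
    [e] tend to [0].
    For (ii), Hahn-Banach produces [q] in the subdifferential of [R] at
    [x^(k+1)] with [|q + xt_(k+1)| <= r_k / tau]; for (i), the proximal map is
    compared with [x^(k+1)] through their variational inequalities. *)

Require Import Defs.
From HB Require Import structures.
From mathcomp Require Import all_boot all_order all_algebra.
From mathcomp Require Import all_classical all_reals all_analysis.
From mathcomp Require Import ring lra.

Import Order.TTheory GRing.Theory Num.Theory.
Import numFieldNormedType.Exports.

Local Open Scope classical_set_scope.
Local Open Scope ring_scope.

(** * Square sums of the tracking errors *)

(** Young's inequality [(a + c)^2 <= kap a^2 + kap / (kap - 1) c^2] turns the recursion into a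
    contraction of the squares with factor [1 / kap], which is then summed. *)
Lemma square_sum_recursion (K : realType) (kap : K) (d g : nat -> K) n :
  1 < kap -> (forall k, 0 <= d k) -> (forall k, 0 <= g k) ->
  (forall k, (k < n)%N -> kap * d k.+1 <= d k + g k) ->
  \sum_(k < n.+1) d k ^+ 2 <=
    kap / (kap - 1) * d 0%N ^+ 2 + (kap - 1) ^- 2 * \sum_(k < n) g k ^+ 2.
Proof.
move=> kap1 d0 g0 dg.
have h0 : 0 < kap - 1 by rewrite subr_gt0.
(* The extra multiple of [d n ^+ 2] is the part that telescopes; it makes the induction close. *)
suff : \sum_(k < n.+1) d k ^+ 2 + (kap - 1)^-1 * d n ^+ 2 <=
    kap / (kap - 1) * d 0%N ^+ 2 + (kap - 1) ^- 2 * \sum_(k < n) g k ^+ 2.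
  by apply: le_trans; rewrite lerDl mulr_ge0 ?sqr_ge0// invr_ge0 ltW.
elim: n dg => [|n IH] dg.
  rewrite big_ord1 big_ord0 mulr0 addr0 -[X in X + _]mul1r -mulrDl.
  rewrite le_eqVlt; apply/orP; left; apply/eqP; congr (_ * _).
  by field; rewrite gt_eqF.
rewrite big_ord_recr [X in _ <= _ + _ * X]big_ord_recr /=.
have {}IH := IH (fun k kn => dg k (ltnW kn)).
suff : d n.+1 ^+ 2 + (kap - 1)^-1 * d n.+1 ^+ 2 <=
    (kap - 1)^-1 * d n ^+ 2 + (kap - 1) ^- 2 * g n ^+ 2.
  by rewrite mulrDr; lra.
have := dg n (ltnSn n); move: (d0 n) (d0 n.+1) (g0 n).
move: (d n) (d n.+1) (g n) => a b c a0 b0 c0 abc.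
have k0 : 0 < kap by lra.
rewrite -(@ler_pM2l _ (kap * (kap - 1) ^+ 2)); last by rewrite mulr_gt0// exprn_gt0.
have -> : kap * (kap - 1) ^+ 2 * (b ^+ 2 + (kap - 1)^-1 * b ^+ 2) =
    (kap - 1) * (kap * b) ^+ 2 by field; rewrite gt_eqF.
have -> : kap * (kap - 1) ^+ 2 * ((kap - 1)^-1 * a ^+ 2 + (kap - 1) ^- 2 * c ^+ 2) =
    kap * (kap - 1) * a ^+ 2 + kap * c ^+ 2 by field; rewrite gt_eqF.
apply: (@le_trans _ _ ((kap - 1) * (a + c) ^+ 2)).
  by rewrite ler_pM2l// lerXn2r ?nnegrE// ?mulr_ge0 ?addr_ge0// ltW.
by have := sqr_ge0 ((kap - 1) * a - c); nra.
Qed.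

Lemma weighted_cauchy_schwarz (K : realType) (a b c e y z : K) :
  0 <= a -> 0 <= b -> 0 < c -> 0 < e ->
  (a * y + b * z) ^+ 2 <= (a * c + b * e) * (a * (y ^+ 2 / c) + b * (z ^+ 2 / e)).
Proof.
move=> a0 b0 c0 e0; rewrite -subr_ge0.
have -> : (a * c + b * e) * (a * (y ^+ 2 / c) + b * (z ^+ 2 / e)) -
    (a * y + b * z) ^+ 2 = a * b * (e * y - c * z) ^+ 2 / (c * e).
  by field; rewrite !gt_eqF.
apply: mulr_ge0; last by rewrite invr_ge0 mulr_ge0// ltW.
by rewrite mulr_ge0 ?sqr_ge0// mulr_ge0.
Qed.

(** * Constants of the tracking estimates and the summed error bound *)

Section tracking_constants.
Context {K : realType}.
Variables pi_u pi_w mu_u ku kw al_u al_w : K.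
Hypotheses (pi_u_gt0 : 0 < pi_u) (pi_w_gt0 : 0 < pi_w) (mu_u_gt0 : 0 < mu_u).
Hypotheses (ku_gt1 : 1 < ku) (kw_gt1 : 1 < kw).
Hypotheses (al_u_ge0 : 0 <= al_u) (al_w_ge0 : 0 <= al_w).

Let ku0 : 0 < ku. Proof. exact: lt_trans ku_gt1. Qed.
Let kw0 : 0 < kw. Proof. exact: lt_trans kw_gt1. Qed.
Let ku10 : 0 < ku - 1. Proof. by rewrite subr_gt0. Qed.
Let kw10 : 0 < kw - 1. Proof. by rewrite subr_gt0. Qed.

Lemma inv_geometric_series_cvg (k : K) : 1 < k ->
  (series (fun j => k ^- j) : nat -> K) @ \oo --> k / (k - 1).
Proof.
move=> k1; have k0 : 0 < k by exact: lt_trans k1.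
have -> : (fun j => k ^- j) = geometric 1 k^-1.
  by apply/funext => j /=; rewrite mul1r exprVn.
have -> : k / (k - 1) = 1 * (1 - k^-1)^-1.
  by field; rewrite !gt_eqF// ?subr_gt0//.
by apply: cvg_geometric_series; rewrite gtr0_norm ?invr_gt0// invf_lt1.
Qed.

(** [iota_c] is a convolution of two geometric sequences; this recursion allows its series to be
    summed without double sums. *)
Lemma iota_cS j :
  kw * iota_c ku kw j.+1 = iota_c ku kw j + ku ^- j.+1.
Proof.
rewrite /iota_c big_nat_recr//= mulrDr; congr (_ + _); last first.
  by rewrite subSnn expr1 mulrCA mulfV ?gt_eqF// mulr1.
rewrite big_distrr/= !big_nat; apply: eq_bigr => m /andP[m1 mj].
rewrite subSn 1?ltnW// exprS invfM.
by rewrite mulrCA [kw * _]mulrA mulfV ?gt_eqF// mul1r.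
Qed.

Lemma iota_c0 : iota_c ku kw 0 = 0.
Proof. by rewrite /iota_c big_geq. Qed.

Lemma iota_c_ge0 j : 0 <= iota_c ku kw j.
Proof.
by apply: sumr_ge0 => m _; rewrite mulr_ge0// invr_ge0 exprn_ge0// ltW.
Qed.

Lemma iota_c_series_cvg :
  series (iota_c ku kw) @ \oo --> ((ku - 1) * (kw - 1))^-1.
Proof.
pose G := series (fun j => ku ^- j) : nat -> K.
have ndG : nondecreasing_seq G.
  apply/nondecreasing_seqP => n; rewrite /G /series/= big_nat_recr//= lerDl.
  by rewrite invr_ge0 exprn_ge0// ltW.
have cG : G @ \oo --> ku / (ku - 1) by exact: inv_geometric_series_cvg.
have G_le n : G n <= ku / (ku - 1).
  rewrite -(cvg_lim (@Rhausdorff K) cG); apply: nondecreasing_cvgn_le => //.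
  by apply/cvg_ex; exists (ku / (ku - 1)).
(* The [- 1] removes the term [j = 0] of [G], since [iota_cS] only produces the powers [ku ^- j]
   with [j >= 1]. *)
have IS n : kw * series (iota_c ku kw) n.+1 =
    series (iota_c ku kw) n + (G n.+1 - 1).
  elim: n => [|n IH].
    rewrite /G /series/= !big_nat1 big_geq// iota_c0 expr0 invr1.
    by rewrite mulr0 subrr addr0.
  rewrite {1}seriesSr mulrDr IH iota_cS [in RHS]seriesSr /G [in RHS](@seriesSr _ _ n.+1).
  by ring.
(* The bound is the fixed point of the limiting recursion [kw l = l + 1 / (ku - 1)], hence it
   propagates by induction. *)
have Ile n : series (iota_c ku kw) n <= ((ku - 1) * (kw - 1))^-1.
  elim: n => [|n IH]; first by rewrite /series/= big_geq// invr_ge0 mulr_ge0// ltW.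
  rewrite -(@ler_pM2l _ kw)// IS.
  have -> : kw * ((ku - 1) * (kw - 1))^-1 =
      ((ku - 1) * (kw - 1))^-1 + (ku / (ku - 1) - 1).
    by field; rewrite !gt_eqF.
  by rewrite lerD// lerB.
have ndI : nondecreasing_seq (series (iota_c ku kw)).
  by apply/nondecreasing_seqP => n; rewrite seriesSr lerDl iota_c_ge0.
have cI : cvgn (series (iota_c ku kw)).
  by apply: nondecreasing_is_cvgn => //; exists ((ku - 1) * (kw - 1))^-1 => _ [n _ <-].
suff <- : limn (series (iota_c ku kw)) = ((ku - 1) * (kw - 1))^-1 by [].
set l := limn _ in cI *.
have c1 : (fun n => kw * series (iota_c ku kw) n.+1) @ \oo --> kw * l.
  by apply: cvgMl_tmp; rewrite cvg_shiftS.
have c2 : (fun n => kw * series (iota_c ku kw) n.+1) @ \oo -->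
    l + (ku / (ku - 1) - 1).
  rewrite (_ : (fun n => _) =
    (fun n => series (iota_c ku kw) n + (G n.+1 - 1))); last exact/funext.
  apply: cvgD => //; apply: cvgB; last exact: cvg_cst.
  by rewrite cvg_shiftS.
have := cvg_unique (@Rhausdorff K) c1 c2 => E.
have : (kw - 1) * l = (ku - 1)^-1.
  by rewrite mulrBl mul1r E; field; rewrite gt_eqF.
by move=> E'; rewrite invfM -E' mulrAC mulfV ?mul1r// gt_eqF.
Qed.

Let kb := Num.max ku kw.
Let kap := Num.min ku kw.
(* [kb * cu] and [kb * cw] are the weights for which the Cauchy-Schwarz
   inequality in [tracking_energy] reproduces [varsigma1] and [Psi1]. *)
Let cu := pi_u / (ku - 1).
Let cw := (mu_u * pi_u / (ku - 1) + pi_w) / (kw - 1).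
Let s1 := varsigma1 pi_u pi_w mu_u ku kw al_u al_w.

Let kb_ku : ku <= kb. Proof. by rewrite le_max lexx. Qed.
Let kb_kw : kw <= kb. Proof. by rewrite le_max lexx orbT. Qed.
Let kb1 : 1 < kb. Proof. exact: lt_le_trans kb_ku. Qed.
Let kap_kw : kap <= kw. Proof. by rewrite ge_min lexx orbT. Qed.
Let kap1 : 1 < kap. Proof. by rewrite lt_min ku_gt1. Qed.
Let kb0 : 0 < kb. Proof. exact: lt_trans kb1. Qed.
Let kap0 : 0 < kap. Proof. exact: lt_trans kap1. Qed.
Let kap10 : 0 < kap - 1. Proof. by rewrite subr_gt0. Qed.
Let cu0 : 0 < cu. Proof. by rewrite divr_gt0. Qed.
Let cw0 : 0 < cw.
Proof. by rewrite divr_gt0// addr_gt0// divr_gt0// mulr_gt0. Qed.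

Lemma psi_c_series_cvg : series (psi_c pi_u pi_w mu_u ku kw al_u al_w) @ \oo -->
  al_u * pi_u * (ku / (ku - 1)) +
  al_w * (mu_u * pi_u * ((ku - 1) * (kw - 1))^-1 + pi_w * (kw / (kw - 1))).
Proof.
rewrite (_ : series _ = (fun n =>
    al_u * pi_u * (series (fun j => ku ^- j) n) +
    al_w * (mu_u * pi_u * (series (iota_c ku kw) n) +
            pi_w * (series (fun j => kw ^- j) n)))); last first.
  apply/funext => n; rewrite /series/= !big_distrr/= -big_split/= big_distrr/=.
  rewrite -big_split/=.
  by apply: eq_bigr => j _; rewrite /psi_c; ring.
apply: cvgD; apply: cvgMl_tmp; first exact: inv_geometric_series_cvg.
apply: cvgD; apply: cvgMl_tmp; first exact: iota_c_series_cvg.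
exact: inv_geometric_series_cvg.
Qed.

(** The exact sum of the series has factors [k / (k - 1)] at places where the weights have
    [1 / (k - 1)]. This is the only property of [varsigma1] that the error bound relies on, besides
    its sign. *)
Lemma varsigma1_ge : kb * (al_u * cu + al_w * cw) <= s1.
Proof.
rewrite /s1 /varsigma1 -/kb ler_pM2l//.
rewrite (cvg_lim (@Rhausdorff K) psi_c_series_cvg) /cu /cw -[al_u * pi_u * _]mulrA lerD//.
  rewrite ler_wpM2l// ler_pM2l// ler_peMl ?invr_ge0// ltW//.
rewrite ler_wpM2l// mulrDl; apply: lerD; first by rewrite invfM !mulrA.
by rewrite ler_pM2l// ler_peMl ?invr_ge0// ltW//.
Qed.

Lemma varsigma1_ge0 : 0 <= s1.
Proof.
apply: le_trans varsigma1_ge; apply: mulr_ge0; first exact: ltW.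
by rewrite addr_ge0// mulr_ge0// ltW.
Qed.

Lemma Psi1_ge0 a b : 0 <= Psi1 pi_u pi_w mu_u ku kw al_u al_w a b.
Proof.
have s0 := varsigma1_ge0; rewrite /Psi1 -/kap -/s1.
have sq_ge0 (c p : K) : 0 < p -> 0 <= c ^+ 2 / p.
  by move=> p0; apply: divr_ge0; [exact: sqr_ge0|exact: ltW].
have kap_ge0 : 0 <= kap / (kap - 1) by rewrite divr_ge0// ltW.
apply: addr_ge0; apply: mulr_ge0; rewrite ?sq_ge0//.
  rewrite addr_ge0//; first by rewrite -mulrA mulr_ge0// mulr_ge0.
  by apply: divr_ge0; rewrite ?sqr_ge0// mulr_ge0 ?(ltW mu_u_gt0)// mulr_ge0.
by rewrite -mulrA mulr_ge0// mulr_ge0.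
Qed.

(** The weights of the Cauchy-Schwarz step total at most [s1]. Dividing the square sums by the same
    weights leaves the coefficient [kb * (al_u * cu + al_w * cw)] on [S], which is the second factor
    [s1]. *)
Lemma tracking_energy (du dw r : nat -> K) n :
  (forall k, 0 <= du k) -> (forall k, 0 <= dw k) -> (forall k, 0 <= r k) ->
  (forall k, (k < n)%N -> ku * du k.+1 <= du k + pi_u * r k) ->
  (forall k, (k < n)%N -> kw * dw k.+1 <= dw k + mu_u * du k.+1 + pi_w * r k) ->
  \sum_(k < n.+1) (al_u * du k + al_w * dw k) ^+ 2 <=
    s1 ^+ 2 * \sum_(k < n) r k ^+ 2 +
    Psi1 pi_u pi_w mu_u ku kw al_u al_w (du 0%N) (dw 0%N).
Proof.
move=> du0 dw0 r0 hu hw.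
set S := \sum_(k < n) r k ^+ 2.
have S0 : 0 <= S by apply: sumr_ge0 => k _; exact: sqr_ge0.
have kbcu0 : 0 < kb * cu by exact: mulr_gt0.
have kbcw0 : 0 < kb * cw by exact: mulr_gt0.
have Hu : \sum_(k < n.+1) du k ^+ 2 <=
    ku / (ku - 1) * du 0%N ^+ 2 + cu ^+ 2 * S.
  apply: le_trans.
    apply: (square_sum_recursion _ _ _ (fun k => pi_u * r k) _ ku_gt1) => //.
    by move=> k; rewrite mulr_ge0// ltW.
  rewrite lerD2l; under eq_bigr do rewrite exprMn.
  by rewrite -big_distrr/= mulrA /cu exprMn exprVn [_ ^+ 2 * _]mulrC.
(* The adjoint recursion involves [du k.+1]; leaving out the first square lowers [ku / (ku - 1)] by
   exactly one. *)
have Hu' : \sum_(k < n) du k.+1 ^+ 2 <= (ku - 1)^-1 * du 0%N ^+ 2 + cu ^+ 2 * S.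
  move: Hu; rewrite big_ord_recl/=.
  have -> : ku / (ku - 1) = 1 + (ku - 1)^-1 by field; rewrite gt_eqF.
  by rewrite mulrDl mul1r -addrA lerD2l.
set m := mu_u * pi_u / (ku - 1).
have m0 : 0 < m by rewrite divr_gt0// mulr_gt0.
(* With the weight [m = mu_u * cu], one has [mu_u^2 / m * cu^2 = m], so both contributions of the
   steps merge into [(m + pi_w)^2 S]. *)
have Hg : \sum_(k < n) (mu_u * du k.+1 + pi_w * r k) ^+ 2 <=
    (m + pi_w) * (mu_u * du 0%N ^+ 2 / pi_u + (m + pi_w) * S).
  apply: (@le_trans _ _ (\sum_(k < n) (m + pi_w) *
      (mu_u ^+ 2 / m * du k.+1 ^+ 2 + pi_w * r k ^+ 2))).
    apply: ler_sum => k _.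
    have := @weighted_cauchy_schwarz K 1 1 m pi_w (mu_u * du k.+1) (pi_w * r k)
      ler01 ler01 m0 pi_w_gt0.
    rewrite !mul1r => /le_trans; apply; rewrite ler_pM2l ?addr_gt0//.
    by rewrite le_eqVlt; apply/orP; left; apply/eqP; field; rewrite !gt_eqF.
  rewrite -big_distrr/= ler_pM2l ?addr_gt0// big_split/= -!big_distrr/= -/S.
  rewrite [(m + _) * _]mulrDl addrA lerD2r.
  apply: le_trans (ler_wpM2l _ Hu') _; first by rewrite divr_ge0 ?sqr_ge0// ltW.
  rewrite le_eqVlt; apply/orP; left; apply/eqP.
  by rewrite /m /cu; field; rewrite !gt_eqF.
have Hw : \sum_(k < n.+1) dw k ^+ 2 <= kw / (kw - 1) * dw 0%N ^+ 2 +
    (kw - 1) ^- 2 * ((m + pi_w) * (mu_u * du 0%N ^+ 2 / pi_u + (m + pi_w) * S)).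
  apply: le_trans.
    apply: (square_sum_recursion _ _ _ (fun k => mu_u * du k.+1 + pi_w * r k) _ kw_gt1) => //.
      by move=> k; rewrite addr_ge0 ?mulr_ge0// ltW.
    by move=> k kn; rewrite addrA hw.
  by rewrite lerD2l ler_wpM2l// invr_ge0 sqr_ge0.
have Hw' : (\sum_(k < n.+1) dw k ^+ 2) / (kb * cw) <= dw 0%N ^+ 2 / pi_w +
    mu_u / (kap - 1) ^+ 2 * (du 0%N ^+ 2 / pi_u) + kb * cw * S.
  rewrite (ler_pdivrMr _ _ kbcw0); apply: le_trans Hw _.
  have -> : cw = (m + pi_w) / (kw - 1) by [].
  have mp0 : 0 < m + pi_w by rewrite addr_gt0.
  set c := (m + pi_w) / (kw - 1).
  set d := mu_u / pi_u * du 0%N ^+ 2.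
  (* Both sides are put in the same monomials and compared by coefficients:
     [kw <= kb (m + pi_w) / pi_w], [(kap - 1)^2 <= kb (kw - 1)] and [1 <= kb^2]. *)
  rewrite [X in X <= _](_ : _ = kw / (kw - 1) * dw 0%N ^+ 2 +
      (kw - 1)^-1 * (d * c) + 1 * (c ^+ 2 * S)); last first.
    by rewrite /c /d; field; rewrite !gt_eqF.
  rewrite [X in _ <= X](_ : _ =
      kb * ((m + pi_w) / pi_w) / (kw - 1) * dw 0%N ^+ 2 +
      kb / (kap - 1) ^+ 2 * (d * c) + kb ^+ 2 * (c ^+ 2 * S)); last first.
    by rewrite /c /d; field; rewrite !gt_eqF.
  have c0 : 0 <= c by rewrite ltW// divr_gt0.
  apply: lerD; first apply: lerD.
  - rewrite ler_wpM2r ?sqr_ge0// ler_pM2r ?invr_gt0//.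
    apply: le_trans kb_kw _; rewrite ler_peMr// ?(ltW kb0)//.
    by rewrite ler_pdivlMr// mul1r lerDr ltW.
  - apply: ler_wpM2r.
      by apply: mulr_ge0 => //; apply: mulr_ge0; rewrite ?sqr_ge0// divr_ge0// ltW.
    rewrite ler_pdivlMr ?exprn_gt0// mulrC ler_pdivrMr//.
    rewrite expr2; apply: ler_pM; rewrite ?lerD2r ?(ltW kap10)//.
    by apply: le_trans (le_trans kap_kw kb_kw); rewrite gerBl.
  - apply: ler_wpM2r; last by rewrite exprn_ege1// ltW.
    by apply: mulr_ge0 => //; exact: sqr_ge0.
have Hu'' : (\sum_(k < n.+1) du k ^+ 2) / (kb * cu) <=
    kap / (kap - 1) * (du 0%N ^+ 2 / pi_u) + kb * cu * S.
  rewrite (ler_pdivrMr _ _ kbcu0); apply: le_trans Hu _.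
  rewrite mulrDl; apply: lerD.
    rewrite [X in _ <= X](_ : _ =
      kap / (kap - 1) * kb / (ku - 1) * du 0%N ^+ 2);
      last by rewrite /cu; field; rewrite !gt_eqF ?subr_gt0.
    rewrite ler_wpM2r ?sqr_ge0// ler_pM2r ?invr_gt0//.
    apply: le_trans kb_ku _; rewrite ler_peMl// ?(ltW kb0)// ltW//.
    by rewrite ltr_pdivlMr// mul1r gtrBl.
  rewrite [X in _ <= X](_ : _ = kb ^+ 2 * (cu ^+ 2 * S)); last by ring.
  apply: ler_peMl; last by rewrite exprn_ege1// ltW.
  by apply: mulr_ge0 => //; exact: sqr_ge0.
apply: (@le_trans _ _ (s1 * (al_u * ((\sum_(k < n.+1) du k ^+ 2) / (kb * cu)) +
    al_w * ((\sum_(k < n.+1) dw k ^+ 2) / (kb * cw))))).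
  apply: (@le_trans _ _ (\sum_(k < n.+1) s1 *
      (al_u * (du k ^+ 2 / (kb * cu)) + al_w * (dw k ^+ 2 / (kb * cw))))).
    apply: ler_sum => k _.
    apply: le_trans.
      exact: (weighted_cauchy_schwarz _ _ _ _ _ _ _ al_u_ge0 al_w_ge0 kbcu0 kbcw0).
    apply: ler_wpM2r.
      by apply: addr_ge0; apply: mulr_ge0 => //; apply: divr_ge0;
        rewrite ?sqr_ge0 ?(ltW kbcu0) ?(ltW kbcw0).
    by rewrite (le_trans _ varsigma1_ge)// mulrDr mulrCA [X in _ + X <= _]mulrCA.
  by rewrite -big_distrr/= big_split/= -!big_distrr/= -!mulr_suml.
have A : 0 <= s1 := varsigma1_ge0.
apply: (@le_trans _ _ (s1 * (al_u * (kap / (kap - 1) * (du 0%N ^+ 2 / pi_u) + kb * cu * S) +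
  al_w * (kap / (kap - 1) * (dw 0%N ^+ 2 / pi_w) +
    mu_u / (kap - 1) ^+ 2 * (du 0%N ^+ 2 / pi_u) + kb * cw * S)))).
  rewrite ler_wpM2l// lerD// ler_wpM2l//.
  (* The term in [dw 0] is enlarged by [kap / (kap - 1) >= 1] to match [Psi1]. *)
  apply: le_trans Hw' _; rewrite !lerD2r ler_peMl//.
    by apply: divr_ge0; rewrite ?sqr_ge0// ltW.
  rewrite ltW//.
  by rewrite ltr_pdivlMr// mul1r gtrBl.
rewrite [X in X <= _](_ : _ = s1 * (kb * (al_u * cu + al_w * cw)) * S +
    Psi1 pi_u pi_w mu_u ku kw al_u al_w (du 0%N) (dw 0%N)); last first.
  by rewrite /Psi1 -/s1 -/kap; field; rewrite !gt_eqF// subr_gt0.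
by rewrite lerD2r ler_wpM2r// expr2 ler_wpM2l// varsigma1_ge.
Qed.

End tracking_constants.

Lemma square_summable_cvg0 (K : realType) (a : nat -> K) (C : K) :
  (forall n, \sum_(k < n) a k ^+ 2 <= C) -> a @ \oo --> (0 : K).
Proof.
move=> aC; have ser : series (fun k => a k ^+ 2) = (fun n => \sum_(k < n) a k ^+ 2).
  by apply/funext => n; rewrite /series/= big_mkord.
have : (fun k => a k ^+ 2) @ \oo --> (0 : K).
  apply: cvg_series_cvg_0; rewrite ser; apply: nondecreasing_is_cvgn.
    by apply/nondecreasing_seqP => n; rewrite big_ord_recr lerDl sqr_ge0.
  by exists C => _ [n _ <-].
move=> /cvgrPdist_lt a2; apply/cvgrPdist_lt => eps eps0.
have := a2 _ (exprn_gt0 2 eps0); apply: filterS => n /=.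
rewrite !sub0r !normrN normrX; apply: contraTT; rewrite -!leNgt => h.
by rewrite lerXn2r ?nnegrE// ltW.
Qed.

(** Young's inequality [e r <= (e^2 + r^2) / 2] and telescoping. The errors up to index [n] are
    controlled by the steps before [n] only, so that the descent can absorb them. *)
Lemma perturbed_descent (K : realType) (F r e : nat -> K) (A s P : K) n :
  (forall k, (k < n.+1)%N -> F k.+1 + A * r k ^+ 2 <= F k + e k * r k) ->
  \sum_(k < n.+1) e k ^+ 2 <= s * \sum_(k < n) r k ^+ 2 + P ->
  0 <= s ->
  F n.+1 + (A - (1 + s) / 2) * \sum_(k < n.+1) r k ^+ 2 <= F 0%N + P / 2.
Proof.
move=> Fd es s0.
have tele m : (m <= n.+1)%N -> F m + (A - 1 / 2) * \sum_(k < m) r k ^+ 2 <=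
    F 0%N + (\sum_(k < m) e k ^+ 2) / 2.
  elim: m => [|m IH] mn; first by rewrite !big_ord0 mulr0 mul0r !addr0.
  have {}IH := IH (ltnW mn); have := Fd _ mn; rewrite !big_ord_recr/=.
  by have := sqr_ge0 (e m - r m); nra.
have := tele _ (leqnn _).
have : s * \sum_(k < n) r k ^+ 2 <= s * \sum_(k < n.+1) r k ^+ 2.
  by rewrite ler_wpM2l// [leRHS]big_ord_recr lerDl sqr_ge0.
move: es; set S := \sum_(k < n.+1) r k ^+ 2; set T := \sum_(k < n.+1) _.
by set Q := \sum_(k < n) _ => *; nra.
Qed.

(** * Hahn-Banach theorem for sublinear functionals *)

Section hahn_banach.
Context {K : realType} {V : lmodType K}.

Definition sublinear (q : V -> K) :=
  (forall x y, q (x + y) <= q x + q y) /\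
  (forall (t : K) x, 0 < t -> q (t *: x) = t * q x).

Lemma sublinear0 q : sublinear q -> q 0 = 0.
Proof.
by move=> sq; have := sq.2 2 0 (ltr0Sn _ _); rewrite scaler0 => h; lra.
Qed.

Lemma sublinear_opp q x : sublinear q -> - q (- x) <= q x.
Proof. by move=> sq; have := sq.1 x (- x); rewrite subrr sublinear0//; lra. Qed.

(* A minimal sublinear functional is linear, since it coincides with
   [x |-> inf_(t >= 0) (q (x + t y) - t q y)] for every [y]. *)
Lemma minimal_sublinear_linear q : sublinear q ->
  (forall q', sublinear q' -> (forall x, q' x <= q x) -> q' = q) -> scalar q.
Proof.
move=> sq qmin.
have [qD qZ] := sq.
have addq x y : q (x + y) = q x + q y.
  apply/eqP; rewrite eq_le qD/=.
  pose A v := [set q (v + t *: y) - t * q y | t in [set t | 0 <= t]].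
  have A0 v : A v (q v) by exists 0; rewrite //= scale0r mul0r addr0 subr0.
  have Alb v : lbound (A v) (- q (- v)).
    move=> _ [t /= t0 <-].
    have tq : q (t *: y) = t * q y.
      move: t0; rewrite le_eqVlt => /orP[/eqP<-|]; last exact: qZ.
      by rewrite scale0r mul0r sublinear0.
    have := qD (v + t *: y) (- v); rewrite addrAC subrr add0r tq; lra.
  have hlb v : has_lbound (A v) by exists (- q (- v)).
  pose q' v := inf (A v).
  have q'_le v z : A v z -> q' v <= z by exact: ge_inf.
  have sq' : sublinear q'.
    split=> [v w|s v s0].
      rewrite -lerBlDr; apply: lb_le_inf; first by exists (q v).
      move=> _ [s /= s0 <-]; rewrite lerBlDl -lerBlDr.
      apply: lb_le_inf; first by exists (q w).
      move=> _ [t /= t0 <-]; rewrite lerBlDr.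
      apply: (@le_trans _ _ (q (v + w + (s + t) *: y) - (s + t) * q y)).
        by apply: q'_le; exists (s + t) => //=; rewrite addr_ge0.
      have := qD (v + s *: y) (w + t *: y); rewrite addrACA -scalerDl; lra.
    apply/eqP; rewrite eq_le; apply/andP; split.
      rewrite -ler_pdivrMl//; apply: lb_le_inf; first by exists (q v).
      move=> _ [t /= t0 <-]; rewrite ler_pdivrMl//; apply: q'_le.
      exists (s * t); first by rewrite /= mulr_ge0// ltW.
      by rewrite -scalerA -scalerDr qZ// mulrBr mulrA.
    apply: lb_le_inf; first by exists (q (s *: v)).
    move=> _ [t /= t0 <-]; rewrite -ler_pdivlMl//; apply: q'_le.
    exists (s^-1 * t); first by rewrite /= mulr_ge0// invr_ge0 ltW.
    rewrite mulrBr mulrA; congr (_ - _); rewrite -qZ ?invr_gt0//.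
    by rewrite scalerDr !scalerA mulVf ?scale1r// gt_eqF.
  (* Minimality forces [q' = q]; the member [t = 1] of [A x] then gives [q x <= q (x + y) - q y]. *)
  have <- : q' x = q x by rewrite (qmin q')// => v; exact: q'_le.
  rewrite -lerBrDr; apply: q'_le; exists 1; rewrite //= ?scale1r ?mul1r//.
have oppq x : q (- x) = - q x.
  by apply/eqP; rewrite -addr_eq0 -addq addNr sublinear0.
move=> t x y; rewrite addq; congr (_ + _).
have [t0|t0|->] := ltgtP t 0; last by rewrite scale0r mul0r sublinear0.
  by rewrite -{1}[t]opprK scaleNr oppq qZ ?oppr_gt0// mulNr opprK.
exact: qZ.
Qed.

(** Zorn's lemma provides a minimal sublinear functional below [p], and minimal ones are linear; no
    extension from subspaces is involved. *)
Lemma hahn_banach_sublinear (p : V -> K) : sublinear p ->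
  exists2 l : V -> K, scalar l & forall x, l x <= p x.
Proof.
move=> sp.
pose P (q : V -> K) := sublinear q /\ forall x, q x <= p x.
pose T := {q : V -> K | P q}.
(* The pointwise order is reversed, so a maximal element for [R] is a minimal functional. *)
pose R (q1 q2 : T) := `[< forall x, sval q2 x <= sval q1 x >].
have [|r s t|s t|A totA|m mmax] := @Zorn T R.
- by move=> t; apply/asboolP.
- by move=> /asboolP rs /asboolP st; apply/asboolP => x; exact: le_trans (rs x).
- move: s t => [s Ps] [t Pt] /asboolP st /asboolP ts.
  apply: eq_exist; apply/funext => x.
  by apply/eqP; rewrite eq_le st ts.
- have [[q0 Aq0]|noA] := pselect (exists q, A q); last first.
    have Pp : P p by split.
    by exists (exist _ p Pp) => s As; exfalso; apply: noA; exists s.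
  pose B v := [set sval q v | q in A].
  have BN v : B v !=set0 by exists (sval q0 v), q0.
  have Blb v : has_lbound (B v).
    exists (- p (- v)) => _ [q Aq <-]; have [sq qp] := svalP q.
    by rewrite (le_trans _ (sublinear_opp _ _ sq))// lerN2.
  (* The pointwise infimum of a nonempty chain is its bound. Subadditivity survives because, of two
     members, the smaller one can be evaluated at both points. *)
  pose q' v := inf (B v).
  have q'_le q v : A q -> q' v <= sval q v.
    by move=> Aq; apply: ge_inf => //; exists q.
  have Pq' : P q'.
    split; last by move=> x; apply: le_trans (q'_le _ x Aq0) _; exact: (svalP q0).2.
    split=> [x y|t x t0].
      rewrite -lerBlDr; apply: lb_le_inf => // _ [q1 Aq1 <-].
      rewrite lerBlDl -lerBlDr; apply: lb_le_inf => // _ [q2 Aq2 <-].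
      rewrite lerBlDr.
      have [/asboolP h|/asboolP h] := totA _ _ Aq1 Aq2.
        apply: le_trans (q'_le _ _ Aq2) _.
        apply: le_trans ((svalP q2).1.1 x y) _.
        by rewrite addrC lerD2l.
      apply: le_trans (q'_le _ _ Aq1) _.
      apply: le_trans ((svalP q1).1.1 x y) _.
      by rewrite [leRHS]addrC lerD2l.
    apply/eqP; rewrite eq_le; apply/andP; split.
      rewrite -ler_pdivrMl//; apply: lb_le_inf => // _ [q Aq <-].
      rewrite ler_pdivrMl//; apply: le_trans (q'_le _ _ Aq) _.
      by rewrite (svalP q).1.2.
    apply: lb_le_inf => // _ [q Aq <-].
    by rewrite (svalP q).1.2// ler_pM2l// q'_le.
  exists (exist _ q' Pq') => q Aq; apply/asboolP => x; exact: q'_le.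
have [sm mp] := svalP m.
exists (sval m) => //; apply: minimal_sublinear_linear => // q' sq' q'm.
have Pq' : P q' by split=> // x; exact: le_trans (mp x).
suff <- : exist _ q' Pq' = m by [].
by apply: mmax; apply/asboolP.
Qed.

End hahn_banach.

(** * Forward-backward steps in normed spaces *)

Section proximal_step.
Context {K : realType} {X : normedModType K}.
Implicit Types (f : X -> \bar K) (x y z v p : X).

(** Convexity of the epigraph: with real upper bounds, no combination of infinite values has to be
    formed. *)
Definition epi_convex f := forall x y (r s t : K), 0 < t < 1 ->
  (f x <= r%:E)%E -> (f y <= s%:E)%E ->
  (f (t *: x + (1 - t) *: y)%R <= (t * r + (1 - t) * s)%:E)%E.

Lemma convex_efun_epi f : convex_efun f -> epi_convex f.
Proof.
move=> cf x y r s t /andP[t0 t1] fx fy; have t1' : 0 < 1 - t by rewrite subr_gt0.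
apply: le_trans (cf x y t _) _; first by rewrite t0.
rewrite (_ : (t * r + _)%:E = t%:E * r%:E + (1 - t)%:E * s%:E)%E//.
by apply: leeD; rewrite lee_pmul2l.
Qed.

Lemma affine_scale_le (a tau r : K) (e : \bar K) : 0 < tau ->
  (a%:E + tau%:E * e <= r%:E)%E = (e <= ((r - a) / tau)%:E)%E.
Proof.
move=> tau0; case: e => [b| |].
- by rewrite -EFinM -EFinD !lee_fin ler_pdivlMr// lerBrDl [tau * b]mulrC.
- by rewrite gt0_muley ?lte_fin// addey.
- by rewrite gt0_muleNy ?lte_fin// addeNy !leNye.
Qed.

Lemma epi_convex_affine_scale f (l : X -> K) (tau : K) : 0 < tau ->
  (forall t x y, l (t *: x + (1 - t) *: y) = t * l x + (1 - t) * l y) ->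
  epi_convex f -> epi_convex (fun z => ((l z)%:E + tau%:E * f z)%E).
Proof.
move=> tau0 ll cf x y r s t t01; rewrite !affine_scale_le// => fx fy.
apply: le_trans (cf _ _ _ _ _ t01 fx fy) _; rewrite lee_fin ll le_eqVlt.
by apply/orP; left; apply/eqP; field; rewrite gt_eqF.
Qed.

Definition prox_objective f v z : \bar K := (f z + (2^-1 * `|z - v| ^+ 2)%:E)%E.

Lemma argmin_prox_fin f v p : (forall z, -oo < f z)%E ->
  (exists z, f z < +oo)%E -> argmin (prox_objective f v) p -> f p \is a fin_num.
Proof.
move=> fN [z fz] /(_ z) pz; rewrite fin_numE -ltNye fN/= -ltey.
move: pz; rewrite /prox_objective; case: (f p) => [a _| |//]; first exact: ltry.
by rewrite addye// leye_eq => /eqP; move: fz; case: (f z).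
Qed.

(** Compares [p] with the point [t *: y + (1 - t) *: p]. The norm is left unexpanded: it is
    estimated by the triangle inequality in a normed space and computed exactly in a Hilbert
    space. *)
Lemma argmin_prox_variation f v p y (a r t : K) : epi_convex f ->
  argmin (prox_objective f v) p -> f p = a%:E -> (f y <= r%:E)%E -> 0 < t < 1 ->
  t * (a - r) <= 2^-1 * (`|(p - v) + t *: (y - p)| ^+ 2 - `|p - v| ^+ 2).
Proof.
move=> cf pm fp fy t01.
have fpa : (f p <= a%:E)%E by rewrite fp.
have fw := cf _ _ _ _ _ t01 fy fpa.
have := pm (t *: y + (1 - t) *: p); rewrite /prox_objective fp -EFinD.
have -> : t *: y + (1 - t) *: p - v = (p - v) + t *: (y - p).
  by rewrite scalerBl scale1r scalerBr addrCA addrAC.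
move=> /le_trans/(_ (leeD2r _ fw)); rewrite -EFinD lee_fin; lra.
Qed.

Lemma le_vanishing (a b c : K) : 0 <= c ->
  (forall t, 0 < t < 1 -> a <= b + t * c) -> a <= b.
Proof.
move=> c0 h; apply/ler_addgt0Pr => e e0.
(* [2^-1] keeps [t] below one, and [c + 1] avoids a division by zero. *)
pose t := Num.min 2^-1 (e / (c + 1)).
have c1 : 0 < c + 1 by rewrite ltr_wpDl.
have t0 : 0 < t by rewrite lt_min invr_gt0 ltr0n divr_gt0.
have t1 : t < 1 by rewrite gt_min invf_lt1// ltr1n.
have te : t * (c + 1) <= e by rewrite -ler_pdivlMr// ge_min lexx orbT.
have := h t; rewrite t0 t1 => /(_ isT); lra.
Qed.

(** A first-order optimality condition without inner product: [t |y - p|] bounds the change of the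
    norm, and [t] tends to zero after division. *)
Lemma argmin_prox_lower_bound f v p y (a r : K) : epi_convex f ->
  argmin (prox_objective f v) p -> f p = a%:E -> (f y <= r%:E)%E ->
  a - `|p - v| * `|y - p| <= r.
Proof.
move=> cf pm fp fy; rewrite lerBlDr -lerBlDl.
apply: (@le_vanishing _ _ (`|y - p| ^+ 2 / 2)); first by rewrite divr_ge0// sqr_ge0.
move=> t t01; have := argmin_prox_variation _ _ _ _ _ _ _ cf pm fp fy t01.
have : `|(p - v) + t *: (y - p)| ^+ 2 <= (`|p - v| + t * `|y - p|) ^+ 2.
  have /andP[t0 _] := t01.
  rewrite lerXn2r ?nnegrE ?addr_ge0 ?mulr_ge0 ?(ltW t0)//.
  by apply: le_trans (ler_normD _ _) _; rewrite normrZ gtr0_norm.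
have /andP[t0 _] := t01.
move: `|_| `|p - v| `|_| => b c d bd h; rewrite -(ler_pM2l t0).
by apply: le_trans h _; lra.
Qed.

(** On the segment towards [v] the norm is exactly [(1 - t) |p - v|]. This gives the coefficient 1,
    where comparing only the values at [p] and [v] would give one half. *)
Lemma argmin_prox_descent f v p (a r : K) : epi_convex f ->
  argmin (prox_objective f v) p -> f p = a%:E -> (f v <= r%:E)%E ->
  a + `|p - v| ^+ 2 <= r.
Proof.
move=> cf pm fp fy.
apply: (@le_vanishing _ _ (`|p - v| ^+ 2 / 2)); first by rewrite divr_ge0// sqr_ge0.
move=> t t01; have := argmin_prox_variation _ _ _ _ _ _ _ cf pm fp fy t01.
have /andP[t0 t1] := t01.
have -> : (p - v) + t *: (v - p) = (1 - t) *: (p - v).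
  by rewrite scalerBl scale1r -(opprB p v) scalerN.
rewrite normrZ gtr0_norm ?subr_gt0//; move: `|_| => b h.
by rewrite -(ler_pM2l t0); lra.
Qed.

(** Chosen so that [prox_objective (linearized R tau g v) v] is the objective of the outer step. *)
Definition linearized (R : X -> \bar K) (tau : K) (g : dual X) v z : \bar K :=
  ((tau * g (z - v))%:E + tau%:E * R z)%E.

Lemma epi_convex_linearized (R : X -> \bar K) (tau : K) (g : dual X) v :
  0 < tau -> epi_convex R -> epi_convex (linearized R tau g v).
Proof.
move=> tau0 cR; apply: epi_convex_affine_scale => // t x y.
have -> : t *: x + (1 - t) *: y - v = t *: (x - v) + ((1 - t) *: (y - v) + 0).
  by rewrite addr0 !scalerBr addrACA -opprD -scalerDl [t + _]addrC subrK scale1r.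
by rewrite !dual_linear dual_map0; ring.
Qed.

Lemma linearized_EFin (R : X -> \bar K) (tau : K) (g : dual X) v z a :
  R z = a%:E -> linearized R tau g v z = (tau * g (z - v) + tau * a)%:E.
Proof. by rewrite /linearized => ->. Qed.

Lemma argmin_linearized_fin (R : X -> \bar K) (tau : K) (g : dual X) v p :
  0 < tau -> proper_efun R -> argmin (prox_objective (linearized R tau g v) v) p ->
  R p \is a fin_num.
Proof.
move=> tau0 [RN [z Rz]] pm.
have : linearized R tau g v p \is a fin_num.
  apply: argmin_prox_fin pm => [y|].
    have := RN y; rewrite /linearized; case: (R y) => [r| |//] _.
      by rewrite -EFinM -EFinD ltNyr.
    by rewrite gt0_muley ?lte_fin// addey.
  exists z; have := RN z; move: Rz; rewrite /linearized.
  by case: (R z) => [r| |//] _ _ //; rewrite -EFinM -EFinD ltry.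
have := RN p; rewrite /linearized; case: (R p) => [//| |//] _.
by rewrite gt0_muley ?lte_fin// addey.
Qed.

Lemma dual_of_bounded (l : X -> K) (c : K) : 0 <= c -> scalar l ->
  (forall x, `|l x| <= c * `|x|) -> exists2 l' : dual X, l' = l :> (X -> K) & `|l'| <= c.
Proof.
move=> c0 sl lc.
have lB x y : l (x - y) = l x - l y.
  by rewrite addrC -scaleN1r sl mulN1r addrC.
have cl : continuous l.
  have c1 : 0 < c + 1 by rewrite ltr_wpDl.
  move=> x; apply/cvgrPdist_lt => e e0; near=> y.
  rewrite -lB; apply: le_lt_trans (lc _) _.
  apply: (@le_lt_trans _ _ ((c + 1) * `|x - y|)); first by rewrite ler_wpM2r// lerDl.
  rewrite -ltr_pdivlMl//; near: y.
  have /cvgrPdist_lt xx : id @ nbhs x --> x by exact: cvg_id.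
  apply: (xx ((c + 1)^-1 * e)).
  by rewrite mulr_gt0 ?invr_gt0.
have P : l \in @dual_pred K X by apply/asboolP.
by exists (Dual P) => //; exact: opnorm_le.
Unshelve. all: by end_near. Qed.

(* Hahn-Banach is applied to the infimal convolution of [c |.|] with the
   sublinear hull [y |-> inf_(t > 0) G(t y) / t] of [G]. *)
Lemma convex_sandwich (G : X -> \bar K) (c : K) : 0 <= c -> epi_convex G ->
  (G 0%R <= 0)%E -> (forall y, (- (c * `|y|))%:E <= G y)%E ->
  exists2 l : dual X, `|l| <= c & forall y, ((l y)%:E <= G y)%E.
Proof.
move=> c0 cG G0 Gc.
pose S h := [set z : K | exists y r t,
  [/\ 0 < t, (G (t *: y) <= (t * r)%:E)%E & z = r + c * `|h - y|]].
have Sc h : S h (c * `|h|).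
  by exists 0, 0, 1; rewrite scaler0 mulr0 subr0 add0r.
have Slb h : lbound (S h) (- (c * `|h|)).
  move=> _ [y [r [t [t0 Gy ->]]]].
  have := le_trans (Gc _) Gy; rewrite lee_fin normrZ gtr0_norm//.
  rewrite mulrCA -mulrN ler_pM2l// => cr.
  apply: le_trans (lerD cr (lexx _)).
  rewrite addrC -mulrBr -mulrN ler_wpM2l// lerBrDr -lerBrDl opprK.
  by rewrite -{1}(subrK h y) distrC ler_normD.
have hS h : has_lbound (S h) by exists (- (c * `|h|)).
have S0 h : S h !=set0 by exists (c * `|h|).
pose s h := inf (S h).
have s_le h (z : K) : S h z -> s h <= z by exact: ge_inf.
have s_sub : sublinear s.
  split=> [x y|t x t0].
    rewrite -lerBlDr; apply: lb_le_inf => // _ [y1 [r1 [t1 [t10 G1 ->]]]].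
    rewrite lerBlDl -lerBlDr; apply: lb_le_inf => // _ [y2 [r2 [t2 [t20 G2 ->]]]].
    rewrite lerBlDr.
    apply: (@le_trans _ _ ((r1 + r2) + c * `|(x + y) - (y1 + y2)|)).
      (* For this scale, the multiple of [y1 + y2] is the convex combination of [t1 *: y1] and
         [t2 *: y2] with weights [t2 / (t1 + t2)] and [t1 / (t1 + t2)]. *)
      apply: s_le; exists (y1 + y2), (r1 + r2), (t1 * t2 / (t1 + t2)).
      have t12 : 0 < t1 + t2 by rewrite addr_gt0.
      split => //; first by rewrite divr_gt0// mulr_gt0.
      have T : 0 < t2 / (t1 + t2) < 1.
        by rewrite divr_gt0//= ltr_pdivrMr// mul1r ltrDr.
      have := cG _ _ _ _ _ T G1 G2; congr (G _ <= _%:E)%E.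
        rewrite !scalerA scalerDr; congr (_ *: _ + _ *: _); field; rewrite gt_eqF//.
      by field; rewrite gt_eqF.
    rewrite [leRHS]addrC [leRHS]addrACA lerD2l -mulrDr ler_wpM2l// opprD addrACA.
    exact: ler_normD.
  have sZ u z : 0 < u -> s (u *: z) <= u * s z.
    move=> u0; rewrite -ler_pdivrMl//; apply: lb_le_inf => // _ [y [r [w [w0 Gw ->]]]].
    rewrite ler_pdivrMl//; apply: s_le; exists (u *: y), (u * r), (w / u); split.
    - by rewrite divr_gt0.
    - by rewrite scalerA divfK ?gt_eqF// mulrA divfK// gt_eqF.
    - by rewrite -scalerBr normrZ gtr0_norm// mulrDr mulrCA.
  apply/eqP; rewrite eq_le sZ//= -ler_pdivlMl//.
  rewrite -{1}[x](@scalerK _ _ t)// ?unitfE ?gt_eqF//.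
  by apply: sZ; rewrite invr_gt0.
have [l sl ls] := hahn_banach_sublinear _ s_sub.
(* Choosing [y = 0] in [S h] bounds [l] by the norm; the choice [y = h], [t = 1] at the end bounds
   it by [G]. *)
have lc h : l h <= c * `|h| by apply: le_trans (ls h) _; exact: s_le.
have lN h : l (- h) = - l h.
  have := sl (-1) h h; rewrite scaleN1r addNr => E0.
  by have := sl (-1) h 0; rewrite addr0 scaleN1r E0; lra.
have [x|l' l'E l'c] := dual_of_bounded _ _ c0 sl.
  by rewrite ler_norml lc andbT lerNl -lN -(normrN x) lc.
exists l' => // y; rewrite l'E.
case Gy : (G y) => [r| |]; last 2 first.
- exact: leey.
- by have := Gc y; rewrite Gy.
rewrite lee_fin; apply: le_trans (ls y) _; apply: s_le.
by exists y, r, 1; rewrite scale1r Gy mul1r subrr normr0 mulr0 addr0.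
Qed.

(** The optimality condition bounds [g h - R p + R (p + h)] below by [- |p - v| / tau * |h|]. A
    functional [l] separating the two gives the subgradient [l - g]. *)
Lemma argmin_linearized_subgradient (R : X -> \bar K) (tau : K) (g : dual X) v p :
  0 < tau -> proper_efun R -> epi_convex R ->
  argmin (prox_objective (linearized R tau g v) v) p ->
  exists2 q, subdiff R p q & `|q + g| <= `|p - v| / tau.
Proof.
move=> tau0 Rproper cR pm; have [RN _] := Rproper.
have Rp := argmin_linearized_fin _ _ _ _ _ tau0 Rproper pm.
have cf := epi_convex_linearized _ _ g v tau0 cR.
pose a := fine (R p); have aE : R p = a%:E by rewrite fineK.
(* The factor [1%:E] gives [G] the form required by [epi_convex_affine_scale]. *)
pose G h := ((g h - a)%:E + 1%:E * R (p + h)%R)%E.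
have [|||y|l lc lG] := @convex_sandwich G (`|p - v| / tau).
- by rewrite divr_ge0// ltW.
- apply: epi_convex_affine_scale => //.
    move=> t x y; rewrite -[(1 - t) *: y]addr0 !dual_linear dual_map0; ring.
  move=> x y r s t t01 Gx Gy.
  suff -> : p + (t *: x + (1 - t) *: y) = t *: (p + x) + (1 - t) *: (p + y) by exact: cR.
  by rewrite !scalerDr addrACA -scalerDl [t + _]addrC subrK scale1r.
- by rewrite /G addr0 aE mul1e -EFinD dual_map0 sub0r addNr.
- rewrite /G mul1e; case Ry : (R (p + y)) => [r| |]; last 2 first.
  + by rewrite addey// leey.
  + by have := RN (p + y); rewrite Ry.
  rewrite -EFinD lee_fin.
  have := argmin_prox_lower_bound _ v p (p + y) _ (tau * g (p + y - v) + tau * r)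
    cf pm (linearized_EFin _ _ _ _ _ _ aE).
  rewrite (linearized_EFin _ _ _ _ _ _ Ry) lexx [p + y - p]addrAC subrr add0r.
  move=> /(_ isT).
  have -> : g (p + y - v) = g (p - v) + g y.
    by rewrite addrAC -{1}[p - v]scale1r dual_linear mul1r.
  move=> h; rewrite mulrAC -mulNr ler_pdivrMr//; lra.
exists (l - g); last by rewrite subrK.
split=> // y.
have := lG (y - p); rewrite /G mul1e subrKC aE.
case Ry : (R y) => [r| |]; last 2 first.
- by move=> _; rewrite leey.
- by have := RN y; rewrite Ry.
rewrite -!EFinD !lee_fin dualDE.
by have -> : (- g) (y - p) = - g (y - p) by []; lra.
Qed.

End proximal_step.

(** * Proximal maps in Hilbert spaces *)

Section hilbert.
Context {K : realType} {X : normedModType K} (ip : X -> X -> K).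
Hypothesis Hip : is_hilbert ip.
Implicit Types (x y z v p : X).

Lemma ipDl x y z : ip (x + y) z = ip x z + ip y z.
Proof. by have [h _ _ _] := Hip; rewrite -[x]scale1r h mul1r scale1r. Qed.

Lemma ip0l z : ip 0 z = 0.
Proof. by apply: (addrI (ip 0 z)); rewrite -ipDl !addr0. Qed.

Lemma ipZl (a : K) x z : ip (a *: x) z = a * ip x z.
Proof. by have [h _ _ _] := Hip; rewrite -[a *: x]addr0 h ip0l addr0. Qed.

Lemma ipC x y : ip x y = ip y x. Proof. by have [_ + _ _] := Hip. Qed.

Lemma ipDr x y z : ip x (y + z) = ip x y + ip x z.
Proof. by rewrite ipC ipDl !(ipC x). Qed.

Lemma ipZr (a : K) x z : ip x (a *: z) = a * ip x z.
Proof. by rewrite ipC ipZl ipC. Qed.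

Lemma ipNl x z : ip (- x) z = - ip x z.
Proof. by rewrite -scaleN1r ipZl mulN1r. Qed.

Lemma ipNr x z : ip x (- z) = - ip x z.
Proof. by rewrite ipC ipNl ipC. Qed.

Lemma ip_norm x : `|x| ^+ 2 = ip x x. Proof. by have [_ _ -> _] := Hip. Qed.

Lemma sqr_normD x y : `|x + y| ^+ 2 = `|x| ^+ 2 + 2 * ip x y + `|y| ^+ 2.
Proof. by rewrite !ip_norm ipDl !ipDr (ipC y x); ring. Qed.

(** The parallelogram identity as strong convexity at the midpoint, with [1 - 2^-1] kept to match
    [epi_convex]. *)
Lemma sqr_norm_midpoint x y v :
  2^-1 * `|2^-1 *: x + (1 - 2^-1) *: y - v| ^+ 2 =
  2^-1 * (2^-1 * `|x - v| ^+ 2) + (1 - 2^-1) * (2^-1 * `|y - v| ^+ 2)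
  - 8^-1 * `|x - y| ^+ 2.
Proof.
rewrite !ip_norm !(ipDl, ipDr, ipZl, ipZr, ipNl, ipNr).
by rewrite (ipC y x) (ipC v x) (ipC v y); field.
Qed.

(* The minimizing sequence is Cauchy by the parallelogram identity. *)
Lemma argmin_prox_exists f v (m : K) : epi_convex f ->
  lower_semicontinuous f -> (exists z, f z < +oo)%E ->
  (forall z, m%:E <= prox_objective f v z)%E ->
  argmin (prox_objective f v) !=set0.
Proof.
have half01 : 0 < (2^-1 : K) < 1 by apply/andP; split; lra.
move=> cf lf [z0 fz0] fm.
pose A := [set r : K | exists z, (prox_objective f v z <= r%:E)%E].
have hA : has_inf A.
  split; last first.
    by exists m => r [z zr]; have := le_trans (fm z) zr; rewrite lee_fin.
  case fz0E : (f z0) fz0 => [a| |]// _.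
    by exists (a + 2^-1 * `|z0 - v| ^+ 2), z0; rewrite /prox_objective fz0E.
  by have := fm z0; rewrite /prox_objective fz0E.
pose I := inf A.
have Ile z : (I%:E <= prox_objective f v z)%E.
  case E : (prox_objective f v z) => [r| |]; last 2 first.
  - by rewrite leey.
  - by have := fm z; rewrite E.
  by rewrite lee_fin; apply: ge_inf; [case: hA|exists z; rewrite E].
have aprox n : exists z, (prox_objective f v z <= (I + n.+1%:R^-1)%:E)%E.
  have [r [z zr] rI] := inf_adherent (@harmonic_gt0 K n) hA.
  by exists z; apply: le_trans zr _; rewrite lee_fin ltW.
have [zz zzP] := choice aprox.
(* The value at the midpoint is at least [I] and, by convexity, at most
   [I + (r + s) / 2 - |x - y|^2 / 8]. *)
have mid_cauchy x y (r s : K) : (prox_objective f v x <= (I + r)%:E)%E ->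
    (prox_objective f v y <= (I + s)%:E)%E -> `|x - y| ^+ 2 <= 4 * (r + s).
  rewrite /prox_objective -!leeBrDr// -!EFinB => hx hy.
  have := Ile (2^-1 *: x + (1 - 2^-1) *: y); rewrite /prox_objective.
  move=> /le_trans/(_ (leeD2r _ (cf _ _ _ _ _ half01 hx hy))).
  rewrite -EFinD lee_fin sqr_norm_midpoint; move: `|x - v| `|y - v| `|x - y|.
  by move=> *; lra.
have cz : cauchy (zz @ \oo).
  apply/cauchy_ballP => e e0.
  have : \forall n \near \oo, 8 * (n.+1%:R^-1 : K) < e ^+ 2.
    have /cvgrPdist_lt h := @cvg_harmonic K.
    have := h (e ^+ 2 / 8); rewrite divr_gt0 ?exprn_gt0// => /(_ isT).
    apply: filterS => n /=; rewrite sub0r normrN gtr0_norm ?invr_gt0//.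
    by rewrite ltr_pdivlMr// mulrC.
  move=> [N _ HN].
  exists ([set zz n | n in [set n | (N <= n)%N]],
          [set zz n | n in [set n | (N <= n)%N]]).
    by split; exists N => // n /= Nn; exists n.
  move=> [_ _] /= [[n Nn <-] [k Nk <-]]; rewrite -ball_normE/=.
  have := mid_cauchy _ _ _ _ (zzP n) (zzP k).
  have := HN _ Nn; have := HN _ Nk; rewrite /=.
  move: (n.+1%:R^-1) (k.+1%:R^-1) => a b hb ha hab.
  have : `|zz n - zz k| ^+ 2 < e ^+ 2 by lra.
  by rewrite ltr_pXn2r ?nnegrE// ltW.
have [_ _ _ cpl] := Hip.
have : cvg (zz @ \oo) by apply: cpl.
move=> /cvg_ex[p zp].
exists p => y; apply: le_trans (Ile y); rewrite leNgt; apply/negP => Ilt.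
pose w := 2^-1 * `|p - v| ^+ 2.
(* If the value at [p] exceeded [I], a real level [a] would fit strictly between. Lower
   semicontinuity keeps [f (zz n)] above [a], and the limit gives [a + w <= I], a contradiction. *)
have : exists2 a : K, I - w < a & (a%:E < f p)%E.
  move: Ilt; rewrite /prox_objective -/w; case: (f p) => [b| |//].
    rewrite -EFinD lte_fin => h; exists ((I - w + b) / 2); rewrite ?lte_fin;
      clearbody I w; lra.
  by move=> _; exists (I - w + 1); rewrite ?ltry//; lra.
move=> [a Iwa afp]; have [V Vp Va] := lf _ _ afp.
suff : a + w <= I by lra.
have c1 : (fun n => a + 2^-1 * `|zz n - v| ^+ 2) @ \oo --> a + w.
  apply: cvgD; first exact: cvg_cst.
  apply: cvgMl_tmp; rewrite expr2; under eq_fun do rewrite expr2.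
  by apply: cvgM; apply: cvg_norm; apply: cvgB => //; exact: cvg_cst.
have c2 : (fun n => I + n.+1%:R^-1) @ \oo --> I + 0.
  by apply: cvgD; [exact: cvg_cst|exact: cvg_harmonic].
rewrite addr0 in c2.
apply: (ler_cvg_to c1 c2).
have zV : \forall n \near \oo, V (zz n) by exact: (zp _ Vp).
apply: filterS zV => n /Va az.
have := zzP n; rewrite /prox_objective -leeBrDr// -EFinB => /(lt_le_trans az).
by rewrite lte_fin ltrBrDr => /ltW.
Qed.

Lemma argmin_prox_ip f v p y (a r : K) : epi_convex f ->
  argmin (prox_objective f v) p -> f p = a%:E -> (f y <= r%:E)%E ->
  a - ip (p - v) (y - p) <= r.
Proof.
move=> cf pm fp fy; rewrite lerBlDr -lerBlDl.
apply: (@le_vanishing _ _ _ (`|y - p| ^+ 2 / 2)); first by rewrite divr_ge0// sqr_ge0.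
move=> t t01; have := argmin_prox_variation _ _ _ _ _ _ _ cf pm fp fy t01.
have /andP[t0 _] := t01.
rewrite sqr_normD ipZr normrZ gtr0_norm// => h; rewrite -(ler_pM2l t0); lra.
Qed.

(** The representative is the minimizer of [|z|^2 / 2 - g z], a proximal point of [- g] at the
    origin. Its optimality condition, used for [h] and [- h], is an equality. *)
Lemma riesz_representation (g : dual X) y : ip (riesz ip g) y = g y.
Proof.
suff [r rP] : exists r, forall y, ip r y = g y.
  by rewrite /riesz; case: xgetP => [r' -> //|/(_ r)].
pose f z := (- g z)%:E : \bar K.
have cf : epi_convex f.
  move=> x z r s t /andP[t0 t1]; rewrite !lee_fin => fx fz.
  rewrite -[(1 - t) *: z]addr0 !dual_linear dual_map0.
  have : t * (- g x) <= t * r by rewrite ler_pM2l.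
  have : (1 - t) * (- g z) <= (1 - t) * s by rewrite ler_pM2l// subr_gt0.
  lra.
have [|||p pm] := @argmin_prox_exists f 0 (- (2^-1 * `|g| ^+ 2)) cf.
- move=> x a; rewrite lte_fin => h.
  have /cvgrPdist_lt/(_ (- g x - a)) := @dual_continuous K X g x.
  rewrite subr_gt0 => /(_ h) => cg.
  exists [set z | `|g x - g z| < - g x - a] => // z /=.
  by rewrite lte_fin distrC => /ltr_normlW; lra.
- by exists 0; rewrite ltry.
- move=> z; rewrite /prox_objective -EFinD lee_fin subr0.
  have := ler_opnorm g z; rewrite -[opnorm g]/(`|g|) => /ler_normlW.
  by have := sqr_ge0 (`|g| - `|z|); nra.
have half h : g h <= ip p h.
  have := @argmin_prox_ip f 0 p (p + h) (- g p) (- g (p + h)) cf pm erefl (lexx _).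
  rewrite subr0 [p + h - p]addrAC subrr add0r addrC.
  by rewrite -[h in g (h + _)]scale1r dual_linear; lra.
exists p => h; apply/eqP; rewrite eq_le half andbT.
have := half (- h); rewrite ipNr -scaleN1r dual_mapZ; lra.
Qed.

(** In the sum of the variational inequalities at [p] and at the proximal point [q], the values of
    [R] and the products with [p - v] cancel, leaving [|q - p|^2 <= tau (gt - gs) (q - p)]. *)
Lemma prox_perturbation (R : X -> \bar K) (tau : K) (gt gs : dual X) v p :
  0 < tau -> proper_efun R -> epi_convex R -> lower_semicontinuous R ->
  argmin (prox_objective (linearized R tau gt v) v) p ->
  `|prox (fun z => tau%:E * R z)%E (v - tau *: riesz ip gs) - p| <=
    tau * `|gs - gt|.
Proof.
move=> tau0 Rproper cR lR pm; have [RN Rdom] := Rproper.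
set f := (fun z => tau%:E * R z)%E; set h := linearized R tau gt v in pm.
set v' := v - _.
have hfE z : (h z = (tau * gt (z - v))%:E + f z)%E by [].
have hc : epi_convex h by exact: epi_convex_linearized.
have fc : epi_convex f.
  rewrite (_ : f = fun z => (0%:E + tau%:E * R z)%E).
    by apply: epi_convex_affine_scale => // t x y; rewrite !mulr0 addr0.
  by apply/funext => z; rewrite add0e.
have fl : lower_semicontinuous f.
  move=> x a; rewrite -lte_pdivrMl// -EFinM => /lR[V Vx Va].
  by exists V => // y /Va; rewrite EFinM lte_pdivrMl.
have fN z : (-oo < f z)%E.
  have := RN z; rewrite /f; case: (R z) => [r| |//] _; first by rewrite -EFinM ltNyr.
  by rewrite gt0_muley ?lte_fin.
have fdom : (exists z, f z < +oo)%E.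
  have [z Rz] := Rdom; exists z; have := RN z; move: Rz; rewrite /f.
  by case: (R z) => [r| |//] _ _ //; rewrite -EFinM ltry.
have fp : f p \is a fin_num.
  by rewrite fin_numM// (argmin_linearized_fin _ _ _ _ _ tau0 Rproper pm).
pose b := fine (f p); have fpE : f p = b%:E by rewrite fineK.
have hE z r : f z = r%:E -> h z = (tau * gt (z - v) + r)%:E.
  by rewrite hfE => ->.
(* A lower bound at the new centre [v'], from the optimality of [p] and completion of the square in
   [|z - v'|]. It yields a minimizer, so [xget] does not return its default. *)
have minor : forall z, ((tau * gt (p - v) + b - `|p - v| * `|v' - p| -
    tau * `|gt| * `|v' - v| - 2^-1 * (`|p - v| + tau * `|gt|) ^+ 2)%:E <=
    prox_objective f v' z)%E.
  move=> z; rewrite /prox_objective; case fz : (f z) => [r| |]; last 2 first.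
  - by rewrite addye// leey.
  - by have := fN z; rewrite fz.
  rewrite -EFinD lee_fin.
  have := @argmin_prox_lower_bound _ _ h v p z _ (tau * gt (z - v) + r) hc pm (hE _ _ fpE).
  rewrite (hE _ _ fz) lexx => /(_ isT).
  have : `|p - v| * `|z - p| <= `|p - v| * (`|z - v'| + `|v' - p|).
    by rewrite ler_wpM2l// ler_distD.
  have : tau * gt (z - v) <= tau * `|gt| * (`|z - v'| + `|v' - v|).
    rewrite -mulrA ler_pM2l//; apply: le_trans (ler_norm _) _.
    apply: le_trans (ler_opnorm gt _) _.
    by rewrite ler_wpM2l ?ler_distD// opnorm_ge0.
  have := sqr_ge0 (`|z - v'| - (`|p - v| + tau * `|gt|)).
  by nra.
have [q0 qm0] := argmin_prox_exists _ _ _ fc fl fdom minor.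
rewrite /prox; case: xgetP => [q _|/(_ q0)//].
rewrite -[(fun z => _)]/(prox_objective f v') => qm.
have fq := argmin_prox_fin _ _ _ fN fdom qm.
pose c := fine (f q); have fqE : f q = c%:E by rewrite fineK.
have := argmin_prox_ip f v' q p c b fc qm fqE.
have := argmin_prox_ip h v p q _ (tau * gt (q - v) + c) hc pm (hE _ _ fpE).
rewrite (hE _ _ fqE) fpE !lexx => /(_ isT) h1 /(_ isT).
have -> : q - v' = (p - v) + ((q - p) + tau *: riesz ip gs).
  by rewrite addrA [p - v + _]addrC addrA subrK /v' opprB addrA addrAC.
rewrite -[p - q]opprB ipNr (ipDl (p - v)) (ipDl (q - p)) ipZl.
rewrite riesz_representation -ip_norm => h2.
have gtE : gt (q - v) = gt (q - p) + gt (p - v).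
  have -> : q - v = 1 *: (q - p) + (p - v) by rewrite scale1r addrA subrK.
  by rewrite dual_linear mul1r.
have : `|q - p| ^+ 2 <= tau * (`|gs - gt| * `|q - p|).
  have := ler_opnorm (gs - gt) (q - p).
  rewrite -[opnorm _]/(`|gs - gt|) dualDE -[(- gt) _]/(- gt (q - p)).
  rewrite ler_norml => /andP[+ _]; rewrite -(ler_pM2l tau0).
  by rewrite gtE in h1; lra.
have [->|qp] := eqVneq `|q - p| 0 => [_|]; first by rewrite mulr_ge0 ?(ltW tau0).
by rewrite mulrA expr2 ler_pM2r// lt_def qp/=.
Qed.

End hilbert.

(** * Convergence of the outer iterates *)

Lemma is_norm_ge0 (K : realType) (V : lmodType K) (N : V -> K) v :
  is_norm N -> 0 <= N v.
Proof.
move=> [_ NZ ND]; have := ND v (-1 *: v); rewrite scaleN1r subrr.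
have := NZ 0 0; rewrite scale0r normr0 mul0r => ->.
by have := NZ (-1) v; rewrite scaleN1r normrN1 mul1r => ->; lra.
Qed.

Lemma nonneg_ereal_cvg0 (K : realType) (g : nat -> \bar K) :
  (forall k, 0 <= g k)%E ->
  (forall eps : K, 0 < eps -> \forall k \near \oo, (g k <= eps%:E)%E) ->
  g @ \oo --> 0%E.
Proof.
move=> g0 gle.
have gfin eps k : (g k <= eps%:E)%E -> g k \is a fin_num.
  by move=> h; rewrite ge0_fin_numE// (le_lt_trans h)// ltry.
apply/fine_cvgP; split.
  by apply: filterS (gle 1 ltr01) => k; exact: gfin.
apply/cvgrPdist_le => eps eps0; apply: filterS (gle eps eps0) => k gk.
rewrite /= sub0r normrN ger0_norm ?fine_ge0//.
by rewrite -lee_fin fineK// (gfin eps).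
Qed.

Lemma nonneg_ereal_squeeze (K : realType) (g : nat -> \bar K) (b : nat -> K) :
  (forall k, 0 <= g k)%E -> (forall k, g k <= (b k)%:E)%E ->
  b @ \oo --> (0 : K) -> g @ \oo --> 0%E.
Proof.
move=> g0 gb /cvgrPdist_le b0; apply: nonneg_ereal_cvg0 => // eps eps0.
apply: filterS (b0 _ eps0) => k /=; rewrite sub0r normrN => /ler_normlW bk.
by apply: le_trans (gb k) _; rewrite lee_fin.
Qed.

Lemma lipschitz_inP (K : realType) (V W : normedModType K) (g : V -> W) (A : set V) :
  [lipschitz g z | z in A] ->
  exists M, forall y z, A y -> A z -> `|g y - g z| <= M * `|y - z|.
Proof.
move=> /pinfty_ex_gt0[M M0 HM]; exists M => y z Ay Az.
by apply: (HM (y, z)).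
Qed.
Theorem theorem4p18 (K : realType) (X U Ws : normedModType K)
  (OmX : set X) (OmU : set U) (E : X -> K) (R : X -> \bar K)
  (R_convex : convex_efun R) (R_proper : proper_efun R)
  (R_lsc : lower_semicontinuous R)
  (ER_bounded : (-oo < ereal_inf [set (E z)%:E + R z | z in [set: X]])%E)
  (* iterates; [xt k.+1] and [xs k.+1] are the estimate and the target at x^k *)
  (x : nat -> X) (tau : K) (xt xs : nat -> dual X) (dE : X -> set (dual X))
  (x0_Om : OmX (x 0%N)) (tau_gt0 : 0 < tau)
  (x_step : forall k, argmin (fun z =>
     ((tau * xt k.+1 (z - x k))%:E + tau%:E * R z
       + (2^-1 * `|z - x k| ^+ 2)%:E)%E) (x k.+1))
  (xs_dE : forall k, dE (x k) (xs k.+1))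
  (* tracking assumption *)
  (Su : X -> U) (Sw : X -> dual Ws) (u : nat -> U) (w : nat -> dual Ws)
  (Dw : nat -> Ws) (Du : nat -> dual U)
  (Nw : Ws -> K) (Nu : dual U -> K) (Nw_norm : is_norm Nw) (Nu_norm : is_norm Nu)
  (pi_u pi_w mu_u kap_u kap_w al_u al_w : K)
  (pi_u_gt0 : 0 < pi_u) (pi_w_gt0 : 0 < pi_w) (mu_u_gt0 : 0 < mu_u)
  (kap_u_gt1 : 1 < kap_u) (kap_w_gt1 : 1 < kap_w)
  (al_u_ge0 : 0 <= al_u) (al_w_ge0 : 0 <= al_w)
  (u_Om : forall k, OmU (u k)) :
  let d_u := track_dist Nw Su x u Dw in
  let d_w := track_dist Nu Sw x w Du in
  let rho k := `|x k - x k.-1| in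
  let in_Om k := forall n, (n <= k)%N -> OmX (x n) /\ OmU (u n) in
  let s1 := varsigma1 pi_u pi_w mu_u kap_u kap_w al_u al_w in
  let P1 := Psi1 pi_u pi_w mu_u kap_u kap_w al_u al_w (d_u 1%N) (d_w 1%N) in
  forall
  (inner_tracking : forall k, in_Om k -> (1 <= k)%N ->
     kap_u * d_u k.+1 <= d_u k + pi_u * rho k)
  (adjoint_tracking : forall k, in_Om k -> (1 <= k)%N ->
     kap_w * d_w k.+1 <= d_w k + mu_u * d_u k.+1 + pi_w * rho k)
  (differential_transformation : forall k, in_Om k ->
     `|xt k.+1 - xs k.+1| <= al_u * d_u k.+1 + al_w * d_w k.+1)
  (L : K) (L_gt0 : 0 < L)
  (descent : forall k z, edom R z ->
     ((E z - E (x k) - L / 2 * `|z - x k| ^+ 2)%:E <=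
       ereal_inf [set (xstar (z - x k))%:E | xstar in dE (x k)])%E)
  (sublevel : [set z | (E z)%:E + R z <= (E (x 0%N))%:E + R (x 0%N) + P1%:E]%E
     `<=` OmX)
  (tau_lt : tau * (L + 1 + s1 ^+ 2) < 2),
  [/\ (fun k => `|u k.+1 - Su (x k)|) @ \oo --> (0 : K),
      (* (i) *)
      forall ip, is_hilbert ip ->
        (fun k => ereal_inf
          [set `|prox (fun z => tau%:E * R z)%E (x k - tau *: riesz ip xstar)
                 - x k|%:E
          | xstar in dE (x k)]) @ \oo --> 0%E
    & (* (ii) *)
      (forall eps : K, 0 < eps -> exists2 delta : K, 0 < delta &
         exists kN : nat, forall k, (kN <= k)%N ->
           `|x k.+1 - x k| <= delta ->
           (set_dist (dE (x k.+1)) (xs k.+1) <= eps%:E)%E)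
      \/
      ((exists m : K, forall z, m <= E z) /\
       forall c : K, let Sc := [set z | OmX z /\ (R z <= c%:E)%E] in
         exists2 g : X -> dual X,
           (forall z, Sc z -> subdiff R z = [set g z]) &
           [lipschitz g z | z in Sc]) ->
      (fun k => ereal_inf
         [set `|a + b|%:E | a in dE (x k.+1) & b in subdiff R (x k.+1)])
        @ \oo --> 0%E].
Proof.
move=> d_u d_w rho in_Om s1 P1 inner_tracking adjoint_tracking
  differential_transformation L L_gt0 descent sublevel tau_lt.
have [RN _] := R_proper.
have cR := convex_efun_epi _ R_convex.
(* Shifted by one: the tracking distances start at index 1, and [Psi1] is formed from [d_u 1] and
   [d_w 1]. *)
pose du k := d_u k.+1; pose dw k := d_w k.+1.
pose r k := `|x k.+1 - x k|; pose e k := `|xt k.+1 - xs k.+1|.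
have du0 k : 0 <= du k by rewrite addr_ge0// is_norm_ge0.
have dw0 k : 0 <= dw k by rewrite addr_ge0// is_norm_ge0.
have r0 k : 0 <= r k by exact: normr_ge0.
have e0 k : 0 <= e k by exact: normr_ge0.
have pm k : argmin (prox_objective (linearized R tau (xt k.+1) (x k)) (x k)) (x k.+1).
  exact: x_step.
have Rfin k : R (x k.+1) \is a fin_num.
  exact: argmin_linearized_fin tau_gt0 R_proper (pm k).
pose A := tau^-1 - L / 2.
pose f k := E (x k) + fine (R (x k)).
(* The value of [F 0] when [R (x 0)] is infinite makes [step] hold at [0]; in
   that case [sublevel] says that [OmX] is the whole space. *)
pose F k := if R (x k) \is a fin_num then f k else f 1%N + A * r 0%N ^+ 2.
have FS k : F k.+1 = f k.+1 by rewrite /F Rfin.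
have step k : F k.+1 + A * r k ^+ 2 <= F k + e k * r k.
  rewrite FS {1}/F; case: ifPn => [Rk|Rk]; last first.
    case: k Rk => [_|k]; last by rewrite Rfin.
    by rewrite lerDl mulr_ge0.
  have RkE : R (x k) = (fine (R (x k)))%:E by rewrite fineK.
  have RSE : R (x k.+1) = (fine (R (x k.+1)))%:E by rewrite fineK.
  have cl := epi_convex_linearized _ _ (xt k.+1) (x k) tau_gt0 cR.
  have := argmin_prox_descent _ _ _ _ (tau * fine (R (x k))) cl (pm k)
    (linearized_EFin _ _ _ _ _ _ RSE).
  rewrite (linearized_EFin _ _ _ _ _ _ RkE) subrr dual_map0 mulr0 add0r lexx.
  move=> /(_ isT) h1.
  have h2 : E (x k.+1) - E (x k) - L / 2 * r k ^+ 2 <= xs k.+1 (x k.+1 - x k).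
    rewrite -lee_fin; apply: le_trans (descent k _ _) _.
      by rewrite /edom /= RSE ltry.
    by apply: ereal_inf_lbound; exists (xs k.+1).
  have h3 : xs k.+1 (x k.+1 - x k) - xt k.+1 (x k.+1 - x k) <= e k * r k.
    have := ler_opnorm (xt k.+1 - xs k.+1) (x k.+1 - x k).
    rewrite -[opnorm _]/(e k) dualDE -[(- xs k.+1) _]/(- xs k.+1 (x k.+1 - x k)).
    by rewrite ler_norml => /andP[+ _]; rewrite -/(r k); lra.
  have h4 : xt k.+1 (x k.+1 - x k) + fine (R (x k.+1)) + tau^-1 * r k ^+ 2 <=
      fine (R (x k)).
    rewrite -(ler_pM2l tau_gt0) !mulrDr mulrA mulfV ?gt_eqF// mul1r.
    exact: h1.
  by rewrite /f /A; lra.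
have in_Om_le m n : (m <= n)%N -> in_Om n -> in_Om m.
  by move=> mn On k km; apply: On; exact: leq_trans mn.
have hu n : in_Om n -> forall k, (k < n)%N -> kap_u * du k.+1 <= du k + pi_u * r k.
  by move=> On k kn; exact: (inner_tracking k.+1 (in_Om_le _ _ kn On)).
have hw n : in_Om n -> forall k, (k < n)%N ->
    kap_w * dw k.+1 <= dw k + mu_u * du k.+1 + pi_w * r k.
  by move=> On k kn; exact: (adjoint_tracking k.+1 (in_Om_le _ _ kn On)).
have he k : in_Om k -> e k <= al_u * du k + al_w * dw k.
  exact: differential_transformation.
have P10 : 0 <= P1 by exact: Psi1_ge0.
(* The positivity of this net descent coefficient is exactly the step length condition. *)
pose c := A - (1 + s1 ^+ 2) / 2.
have c0 : 0 < c.
  rewrite (_ : c = (2 - tau * (L + 1 + s1 ^+ 2)) / (2 * tau)); last first.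
    by rewrite /c /A; field; rewrite gt_eqF.
  by rewrite divr_gt0 ?subr_gt0// mulr_gt0.
have energy n : in_Om n -> F n.+1 + c * \sum_(k < n.+1) r k ^+ 2 <= F 0%N + P1 / 2.
  move=> On; apply: (@perturbed_descent _ F r (fun k => al_u * du k + al_w * dw k)).
  - move=> k kn; apply: le_trans (step k) _; rewrite lerD2l ler_wpM2r//.
    exact: (he k (in_Om_le k n kn On)).
  - exact: (tracking_energy pi_u pi_w mu_u kap_u kap_w al_u al_w
      _ _ _ _ _ _ _ _ _ _ _ du0 dw0 r0 (hu _ On) (hw _ On)).
  - exact: sqr_ge0.
have sum_r_ge0 n : 0 <= \sum_(k < n) r k ^+ 2 by apply: sumr_ge0 => k _; exact: sqr_ge0.
have F_le n : in_Om n -> F n.+1 <= F 0%N + P1 / 2.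
  by move=> /energy; apply: le_trans; rewrite lerDl mulr_ge0// ltW.
(* The energy bound for [F n.+1] needs only the iterates up to [n] in [OmX], so membership of the
   next iterate follows by induction. *)
have all_Om n : in_Om n.
  elim: n => [|n IH] k; first by rewrite leqn0 => /eqP->.
  rewrite leq_eqVlt => /orP[/eqP->|]; last exact: IH.
  split=> //; apply: sublevel => /=.
  have [R0|R0] := boolP (R (x 0%N) \is a fin_num); last first.
    suff -> : R (x 0%N) = +oo%E by rewrite addey// addye// leey.
    by move: (RN (x 0%N)) R0; case: (R (x 0%N)).
  have := F_le _ IH; rewrite FS /f /F R0 => h.
  rewrite -(fineK (Rfin n)) -(fineK R0) -!EFinD lee_fin.
  by apply: le_trans h _; rewrite lerD2l; lra.
have [m Fm] : exists m, forall k, m <= F k.+1.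
  have inf_le k : (ereal_inf [set (E z)%:E + R z | z in [set: X]] <= (F k.+1)%:E)%E.
    by apply: ereal_inf_lbound; exists (x k.+1) => //; rewrite FS /f EFinD fineK.
  move: ER_bounded inf_le; case: (ereal_inf _) => [m| |//] _ h; first by exists m.
  by have := h 0%N; rewrite leye_eq.
pose C := (F 0%N + P1 / 2 - m) / c.
have r_sum n : \sum_(k < n) r k ^+ 2 <= C.
  apply: (@le_trans _ _ (\sum_(k < n.+1) r k ^+ 2)).
    by rewrite [leRHS]big_ord_recr lerDl sqr_ge0.
  rewrite ler_pdivlMr// mulrC; have := energy n (all_Om n); have := Fm n; lra.
have r_cvg : r @ \oo --> (0 : K) by exact: square_summable_cvg0 r_sum.
(* With all iterates in [OmX] and [r] square summable, the recursions now bound [du] and [dw]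
   separately; the values of the constants no longer matter. *)
have [D du_le] : exists D, forall n, \sum_(k < n) du k ^+ 2 <= D.
  exists (kap_u / (kap_u - 1) * du 0%N ^+ 2 + (kap_u - 1) ^- 2 * (pi_u ^+ 2 * C)) => n.
  apply: (@le_trans _ _ (\sum_(k < n.+1) du k ^+ 2)).
    by rewrite [leRHS]big_ord_recr lerDl sqr_ge0.
  apply: le_trans (square_sum_recursion _ _ _ (fun k => pi_u * r k) n kap_u_gt1 du0 _ _) _.
  - by move=> k; rewrite mulr_ge0// ltW.
  - exact: hu (all_Om n).
  rewrite lerD2l ler_wpM2l ?invr_ge0 ?sqr_ge0//.
  under eq_bigr do rewrite exprMn.
  by rewrite -big_distrr/= ler_wpM2l ?sqr_ge0 ?r_sum.
have du_cvg : du @ \oo --> (0 : K) by exact: square_summable_cvg0 du_le.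
have dw_cvg : dw @ \oo --> (0 : K).
  apply: (square_summable_cvg0 _ _ (kap_w / (kap_w - 1) * dw 0%N ^+ 2 +
    (kap_w - 1) ^- 2 * (2 * mu_u ^+ 2 * D + 2 * pi_w ^+ 2 * C))) => n.
  apply: (@le_trans _ _ (\sum_(k < n.+1) dw k ^+ 2)).
    by rewrite [leRHS]big_ord_recr lerDl sqr_ge0.
  apply: le_trans (square_sum_recursion _ _ _ (fun k => mu_u * du k.+1 + pi_w * r k)
    n kap_w_gt1 dw0 _ _) _.
  - by move=> k; rewrite addr_ge0// mulr_ge0// ltW.
  - by move=> k kn; rewrite addrA; exact: hw (all_Om n) k kn.
  rewrite lerD2l ler_wpM2l ?invr_ge0 ?sqr_ge0//.
  apply: (@le_trans _ _ (\sum_(k < n)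
      (2 * mu_u ^+ 2 * du k.+1 ^+ 2 + 2 * pi_w ^+ 2 * r k ^+ 2))).
    apply: ler_sum => k _.
    by have := sqr_ge0 (mu_u * du k.+1 - pi_w * r k); nra.
  have shift : \sum_(k < n) du k.+1 ^+ 2 <= D.
    apply: le_trans (du_le n.+1); rewrite [leRHS]big_ord_recl/=.
    by rewrite lerDr sqr_ge0.
  rewrite big_split/= -!big_distrr/= lerD// ler_wpM2l ?shift ?r_sum//.
    by apply: mulr_ge0 => //; exact: sqr_ge0.
  by apply: mulr_ge0 => //; exact: sqr_ge0.
have e_cvg : e @ \oo --> (0 : K).
  apply: (@squeeze_cvgr _ _ _ _ (cst 0) (fun k => al_u * du k + al_w * dw k)).
  - by near=> k; rewrite e0 he.
  - exact: cvg_cst.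
  - have <- : al_u * 0 + al_w * 0 = 0 by rewrite !mulr0 addr0.
    by apply: cvgD; apply: cvgMl_tmp.
have sub k := argmin_linearized_subgradient _ _ _ _ _ tau_gt0 R_proper cR (pm k).
split.
- apply: (@squeeze_cvgr _ _ _ _ (cst 0) du) => //; last exact: cvg_cst.
  by near=> k; rewrite normr_ge0/= /du /d_u /track_dist lerDl is_norm_ge0.
- move=> ip Hip; apply: (@nonneg_ereal_squeeze _ _ (fun k => tau * e k + r k)).
  + by move=> k; apply: le_ereal_inf_tmp => _ [a _ <-]; rewrite lee_fin.
  (* The target [xs k.+1] is the competitor; its proximal point is within [tau * e k] of [x k.+1],
     which is [r k] away from [x k]. *)
  + move=> k; apply: ge_ereal_inf.
    exists `|prox (fun z => tau%:E * R z)%E (x k - tau *: riesz ip (xs k.+1)) - x k|%:E.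
      by exists (xs k.+1).
    rewrite lee_fin; apply: le_trans (ler_distD (x k.+1) _ _) _.
    rewrite lerD2r /e [`|xt _ - _|]distrC.
    exact: prox_perturbation _ Hip _ _ _ _ _ _ tau_gt0 R_proper cR R_lsc (pm k).
  + have <- : tau * 0 + 0 = 0 by rewrite mulr0 addr0.
    by apply: cvgD => //; apply: cvgMl_tmp.
have inf_ge0 k : (0 <= ereal_inf
    [set `|a + b|%:E | a in dE (x k.+1) & b in subdiff R (x k.+1)])%E.
  by apply: le_ereal_inf_tmp => _ [a _ [b _ <-]]; rewrite lee_fin.
case=> [near_targets|[[mE mE_le] lipR]].
- apply: nonneg_ereal_cvg0 => // eps eps0.
  have [delta delta0 [kN HkN]] := near_targets _ (divr_gt0 eps0 (ltr0Sn K 3)).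
  have rt_cvg : (fun k => r k / tau) @ \oo --> (0 : K).
    by rewrite -(mul0r tau^-1); apply: cvgMr_tmp.
  move/cvgrPdist_le : e_cvg => /(_ (eps / 4)) e_small.
  move/cvgrPdist_le : rt_cvg => /(_ (eps / 4)) rt_small.
  move/cvgrPdist_le : r_cvg => /(_ _ delta0) r_small.
  have eps4 : 0 < eps / 4 by rewrite divr_gt0.
  near=> k.
  have rk : r k <= delta.
    have : `|0 - r k| <= delta by near: k.
    by rewrite sub0r normrN ger0_norm.
  have ek : e k <= eps / 4.
    have : `|0 - e k| <= eps / 4 by near: k; exact: e_small.
    by rewrite sub0r normrN ger0_norm.
  have rtk : r k / tau <= eps / 4.
    have : `|0 - r k / tau| <= eps / 4 by near: k; exact: rt_small.
    by rewrite sub0r normrN ger0_norm// divr_ge0// ltW.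
  have kNk : (kN <= k)%N by near: k; exists kN.
  (* The distance is an infimum that may not be attained; relaxing [eps / 4] to a strict bound
     [eps / 2] provides an element [a]. *)
  have : (set_dist (dE (x k.+1)) (xs k.+1) < (eps / 2)%:E)%E.
    by apply: le_lt_trans (HkN _ kNk rk) _; rewrite lte_fin; lra.
  move=> /ereal_inf_lt[_ [a aE <-]]; rewrite lte_fin => ha.
  have [q qR hq] := sub k; rewrite -/(r k) in hq.
  apply: ge_ereal_inf; exists `|a + q|%:E; first by exists a => //; exists q.
  rewrite lee_fin.
  have -> : a + q = (a - xs k.+1) + ((xs k.+1 - xt k.+1) + (q + xt k.+1)).
    by rewrite [q + _]addrC addrA subrKA addrA subrK.
  apply: le_trans (ler_normD _ _) _.
  have := ler_normD (xs k.+1 - xt k.+1) (q + xt k.+1).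
  by rewrite (distrC a) (distrC (xs k.+1) (xt k.+1)) -/(e k); lra.
- have Fbd k : R (x k.+1) = (fine (R (x k.+1)))%:E by rewrite fineK.
  (* This level bounds [R] along the iterates, because [F] stays below [F 0 + P1 / 2] and [E] above
     [mE]. *)
  have [g gsub /lipschitz_inP[M HM]] := lipR (F 0%N + P1 / 2 - mE).
  have Sx k : OmX (x k.+1) /\ (R (x k.+1) <= (F 0%N + P1 / 2 - mE)%:E)%E.
    split; first by have [] := all_Om k.+1 k.+1 (leqnn _).
    rewrite Fbd lee_fin; have := F_le _ (all_Om k); rewrite FS /f.
    by have := mE_le (x k.+1); lra.
  apply: (@nonneg_ereal_squeeze _ _ (fun k => e k.+1 + r k.+1 / tau + M * r k.+1)) => //.
    move=> k; have [q qR hq] := sub k.+1.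
    have qE : q = g (x k.+2) by move: qR; rewrite gsub//; exact: Sx.
    apply: ge_ereal_inf; exists `|xs k.+2 + g (x k.+1)|%:E.
      by exists (xs k.+2) => //; exists (g (x k.+1)) => //; rewrite gsub//; exact: Sx.
    rewrite lee_fin.
    (* The target in [dE (x k.+1)] has index [k.+2], whereas the step provides a subgradient at
       [x k.+2]; the Lipschitz property moves it back to [x k.+1]. *)
    have -> : xs k.+2 + g (x k.+1) = (xs k.+2 - xt k.+2) + (q + xt k.+2) +
        (g (x k.+1) - g (x k.+2)).
      by rewrite qE [g _ + xt _]addrC subrKA addrAC addrA addrAC addrK.
    apply: le_trans (ler_normD _ _) _; apply: lerD; last first.
      by rewrite distrC; apply: HM; exact: Sx.
    apply: le_trans (ler_normD _ _) _.
    by rewrite distrC lerD.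
  have <- : 0 + 0 / tau + M * 0 = 0 by rewrite mul0r mulr0 !addr0.
  apply: cvgD; first apply: cvgD.
  + by rewrite (cvg_shiftS e).
  + by apply: cvgMr_tmp; rewrite (cvg_shiftS r).
  + by apply: cvgMl_tmp; rewrite (cvg_shiftS r).
Unshelve. all: by end_near. Qed.
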